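(* Let $x>0$ be fixed, let $L_{i\nu}(x)=\frac{\pi}{2\sinh \pi\nu}\{I_{i\nu}(x)+I_{-i\nu}(x)\}$, and let $\nu_n$ denote the $n$th positive $\nu$-zero of $L_{i\nu}(x)$ (labelled as specified in the context). Put $\lambda=2/(ex)$, $m_+=(n+\frac14)\pi$ and $\xi_n=m_+/W(\lambda m_+)$. Then $$\nu_n\sim \frac{m_+}{W(\lambda m_+)}+\frac{B_0}{m_+}+\frac{B_1}{m_+^3}+\frac{B_2}{m_+^5}+\cdots\qquad (n\to\infty),$$ where the coefficients $B_0,B_1,B_2$ (which depend on $x$ and $n$) are those defined in the context with $m=m_+$. Here $\sim$ means that for each $K\in\{0,1,2\}$, $$\nu_n=\xi_n+\sum_{k=0}^{K}\frac{B_k}{m_+^{2k+1}}+O\bigl(\xi_n^{-(2K+3)}\bigr)\qquad (n\to\infty).$$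
   Context: $I_{\pm i\nu}(x)$ is the modified Bessel function of the first kind of order $\pm i\nu$, with $I_{i\nu}(x)=\frac{(x/2)^{i\nu}}{\Gamma(1+i\nu)}\sum_{k\ge0}\frac{(x/2)^{2k}}{k!\,(1+i\nu)_k}$, where $(a)_k=\Gamma(a+k)/\Gamma(a)$. For $z>0$, $W(z)$ is the Lambert function: the positive solution of $W(z)e^{W(z)}=z$. A $\nu$-zero is a zero of the function regarded as a function of the real variable $\nu>0$ with $x>0$ fixed. Labelling of zeros: let $\Phi(\nu)=\nu\log(\lambda\nu)+\frac{\pi}{4}$ with $\lambda=2/(ex)$. The large positive zeros are labelled by large positive integers $n$ so that $\Phi(\nu_n)=(n+\frac12)\pi-\epsilon_n$ with $\epsilon_n\to0$ as $n\to\infty$. Stirling coefficients: $\gamma_0=1$, $\gamma_1=-\frac1{12}$, $\gamma_2=\frac1{288}$, $\gamma_3=\frac{139}{51840}$, $\gamma_4=-\frac{571}{2488320}$, $\gamma_5=-\frac{163879}{209018880}$. Polynomials: $C_0(c)=1$, $C_1(c)=c$, $C_2(c)=\frac c2(-2+c)$, $C_3(c)=\frac c6(6-9c+c^2)$, $C_4(c)=\frac c{24}(-24+84c-24c^2+c^3)$, $C_5(c)=\frac c{120}(120-900c+500c^2-50c^3+c^4)$. With $c=x^2/4$ set $a_0=1$ and $a_k=C_k(c)+\sum_{r=1}^k\gamma_rC_{k-r}(c)$ for $1\le k\le5$. Then $A_0=a_1$, $A_1=a_1a_2-a_3-\frac13a_1^3$, $A_2=a_1a_2^2+a_1^2a_3-a_1^3a_2-a_2a_3-a_1a_4+a_5+\frac15a_1^5$.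 For $m>0$ put $\xi=m/W(\lambda m)$ (so that $\xi\log(\lambda\xi)=m$) and $\rho=\xi/m$ (so that $1+\log(\lambda\xi)=(1+\rho)/\rho$). Define $b_0=\dfrac{-A_0}{1+\log(\lambda\xi)}$, $\quad b_1=\dfrac{A_0b_0-A_1-\frac12b_0^2}{1+\log(\lambda\xi)}$, and $$B_0=\frac{-A_0}{1+\rho},\qquad B_1=\frac{A_0b_0-A_1-\frac12b_0^2}{\rho^2(1+\rho)},\qquad B_2=\frac{3A_1b_0-A_0(b_0^2-b_1)-A_2-b_0b_1+\frac16b_0^3}{\rho^4(1+\rho)}.$$ *)

(* Defs.v *)
(* Stdlib reals with Coquelicot *)
From Stdlib Require Export Reals Factorial.
From Coquelicot Require Export Coquelicot.

Open Scope R_scope.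

(** * Modified Bessel functions of complex order *)

(** [t ^ z] for [t > 0]: the principal branch [exp (z * ln t)]. *)
Definition rcpow (t : R) (z : C) : C :=
  (Rpower t (Re z) * cos (Im z * ln t), Rpower t (Re z) * sin (Im z * ln t)).

(** Euler's integral over [(0, +oo)].  It is meaningful for [Re z > 0], which
    covers every argument [1 + mu + k] with [mu] purely imaginary. *)
Definition Gamma (z : C) : C :=
  RInt_gen (V := C_R_CompleteNormedModule)
    (fun t : R => (rcpow t (z - 1) * exp (- t))%C)
    (at_right 0) (Rbar_locally p_infty).

Definition poch (a : C) (k : nat) : C := (Gamma (a + INR k) / Gamma a)%C.

(** The unique limit of the partial sums, when they converge. *)
Definition CSeries (a : nat -> C) : C :=
  iota (fun s : C_CompleteNormedModule =>
          is_series (K := C_AbsRing) (V := C_NormedModule) a s).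

Definition besselI (mu : C) (x : R) : C :=
  (rcpow (x / 2) mu / Gamma (1 + mu)
   * CSeries (fun k => (x / 2) ^ (2 * k)
                       / (INR (fact k) * poch (1 + mu) k)))%C.

Definition Lfun (x nu : R) : C :=
  (RtoC (PI / (2 * sinh (PI * nu)))
   * (besselI (Ci * nu) x + besselI (- (Ci * nu)) x))%C.

(** * Labelling of the zeros *)

Definition lambda (x : R) : R := 2 / (exp 1 * x).

Definition Phi (x nu : R) : R := nu * ln (lambda x * nu) + PI / 4.

(** Only the values [nu n] for large [n] are constrained. *)
Definition is_zero_labelling (x : R) (nu : nat -> R) : Prop :=
  (exists N : nat, forall n : nat, (N <= n)%nat ->
     0 < nu n /\ Lfun x (nu n) = RtoC 0) /\
  is_lim_seq (fun n => (INR n + 1 / 2) * PI - Phi x (nu n)) 0.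

(** * Coefficients of the expansion *)

(** For [z > 0] the map [w |-> w * exp w] is a bijection of [(0, +oo)], so the
    description below has exactly one solution. *)
Definition LambertW (z : R) : R :=
  iota (fun w : R_CompleteNormedModule => 0 < w /\ w * exp w = z).

(** Coefficients of [1/z^k] in the large-[z] expansion of
    [sqrt (2 * PI * z) * (z/e)^z / Gamma (1 + z)]; only [k <= 5] is used. *)
Definition stirling (k : nat) : R :=
  match k with
  | 0 => 1
  | 1 => - 1 / 12
  | 2 => 1 / 288
  | 3 => 139 / 51840
  | 4 => - 571 / 2488320
  | 5 => - 163879 / 209018880
  | _ => 0
  end.

(** Coefficients of [1/z^k] in the large-[z] expansion of
    [sum_k c^k / (k! (1+z)_k)]; only [k <= 5] is used. *)
Definition Cpoly (k : nat) (c : R) : R :=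
  match k with
  | 0 => 1
  | 1 => c
  | 2 => c / 2 * (- 2 + c)
  | 3 => c / 6 * (6 - 9 * c + c ^ 2)
  | 4 => c / 24 * (- 24 + 84 * c - 24 * c ^ 2 + c ^ 3)
  | 5 => c / 120 * (120 - 900 * c + 500 * c ^ 2 - 50 * c ^ 3 + c ^ 4)
  | _ => 0
  end.

(** The sum is empty for [k = 0], so [acoef x 0 = 1]. *)
Definition acoef (x : R) (k : nat) : R :=
  let c := x ^ 2 / 4 in
  Cpoly k c + sum_n_m (fun r => stirling r * Cpoly (k - r) c) 1 k.

Definition A0 (x : R) : R := acoef x 1.

Definition A1 (x : R) : R :=
  acoef x 1 * acoef x 2 - acoef x 3 - 1 / 3 * acoef x 1 ^ 3.

Definition A2 (x : R) : R :=
  acoef x 1 * acoef x 2 ^ 2 + acoef x 1 ^ 2 * acoef x 3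
  - acoef x 1 ^ 3 * acoef x 2 - acoef x 2 * acoef x 3
  - acoef x 1 * acoef x 4 + acoef x 5 + 1 / 5 * acoef x 1 ^ 5.

Definition xi (x m : R) : R := m / LambertW (lambda x * m).

Definition rho (x m : R) : R := xi x m / m.

Definition b0 (x m : R) : R := - A0 x / (1 + ln (lambda x * xi x m)).

Definition b1 (x m : R) : R :=
  (A0 x * b0 x m - A1 x - 1 / 2 * b0 x m ^ 2) / (1 + ln (lambda x * xi x m)).

Definition B0 (x m : R) : R := - A0 x / (1 + rho x m).

Definition B1 (x m : R) : R :=
  (A0 x * b0 x m - A1 x - 1 / 2 * b0 x m ^ 2)
  / (rho x m ^ 2 * (1 + rho x m)).

Definition B2 (x m : R) : R :=
  (3 * A1 x * b0 x m - A0 x * (b0 x m ^ 2 - b1 x m) - A2 x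
   - b0 x m * b1 x m + 1 / 6 * b0 x m ^ 3)
  / (rho x m ^ 4 * (1 + rho x m)).

(** Only [k <= 2] is used. *)
Definition Bcoef (x m : R) (k : nat) : R :=
  match k with
  | 0 => B0 x m
  | 1 => B1 x m
  | 2 => B2 x m
  | _ => 0
  end.

Definition m_plus (n : nat) : R := (INR n + 1 / 4) * PI.

(* Main.v *)
Require Import Defs.
From Stdlib Require Import Lra Lia Psatz List.
Import ListNotations.

(** Since [I_{-i nu} (x)] is the conjugate of [I_{i nu} (x)], the zeros of
    [L_{i nu} (x)] are the [nu] at which [I_{i nu} (x)] is purely imaginary.  So
    only the argument of
    [I_{i nu} (x) = (x/2)^{i nu} / Gamma (1 + i nu) * S (nu)] matters, modulo [PI]
    and with an error [O (nu^-7)].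

    The argument of [Gamma (1 + i nu)] comes from three facts ([gamma_angle]).
    Integration by parts gives
    [Gamma (1 + i nu + n) = (n + i nu) ... (1 + i nu) Gamma (1 + i nu)].  The
    weight [t^N e^-t / N!] has mean and variance about [N], so that
    [Gamma (1 + i nu + N) / N!] is asymptotic to [N^{i nu}] as [N] grows
    ([Gm_asymptotics]).  Finally, let [stirling_arg nu s] be the imaginary part of
    the truncated Stirling series of [log Gamma (1 + z)] at [z = s + i nu]; its
    increment from [s - 1] to [s] is the argument of [s + i nu] up to
    [O (|z|^-8)] ([stirling_arg_step]).  Summing these errors over [s = 1, 2, ...]
    costs only [O (nu^-7)], hence the argument of [Gamma (1 + i nu)] is
    [stirling_arg nu 0 + O (nu^-7)].

    In terms of [w = 1/(i nu)], the series [S (nu)] equals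
    [sum_{k <= 6} C_k w^k + O (w^7)] with real coefficients
    ([series_expansion]).  Multiplied by
    [cis (alpha0/nu + alpha1/nu^3 + alpha2/nu^5)], itself a power series in [w]
    with real coefficients, it loses its terms in [w], [w^3] and [w^5] for a
    unique choice of the [alpha]s, namely [A_0 + 1/12], [A_1 + 1/360] and
    [A_2 + 1/1260] ([phase_coefs_vanish]).  What is left is real up to
    [O (nu^-7)], because [w^2] is real.  The summands [1/12], [1/360], [1/1260]
    cancel against Stirling's series.  Together, a zero satisfies
    [cos (Phi (nu) + A_0/nu + A_1/nu^3 + A_2/nu^5) = O (nu^-7)]
    ([zero_condition]), and the labelling turns this into
    [nu log (lambda nu) = m - A_0/nu - A_1/nu^3 - A_2/nu^5 + O (nu^-7)] with
    [m = (n + 1/4) PI] ([zero_equation]).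

    This equation is solved around the solution [xi] of
    [xi log (lambda xi) = m].  With [L = 1 + log (lambda xi) >= 1], [k = xi^-2] and
    [y = xi (nu - xi)], Taylor expansion gives [L y = G (y, k) + O (k^3)] for a
    polynomial [G], and three rounds of substitution produce the coefficients
    [b_0], [b_1], [b_2] of [y] in powers of [k] with bounds that do not depend on
    [L] ([implicit_expansion], [expansion_around_xi]).  Rewriting
    [b_j / xi^(2j+1)] with [rho = xi/m] gives [B_j / m^(2j+1)]. *)

(** * Convergence of Euler's integral *)

(** The form in which the two-sided limit defining an integral over [(0, +oo)] is
    used throughout: properties of the bounds may be assumed for [0 < a < 1 < b]. *)
Lemma filter_prod_pos (P : R * R -> Prop) :
  (forall a b, 0 < a -> a < 1 -> 1 < b -> P (a, b)) ->
  filter_prod (at_right 0) (Rbar_locally p_infty) P.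
Proof.
  intros H.
  apply Filter_prod with (fun a => 0 < a < 1) (fun b => 1 < b).
  - exists (mkposreal 1 Rlt_0_1). intros a Ha Ha0. split; [exact Ha0|].
    revert Ha. unfold ball; simpl; unfold AbsRing_ball, abs, minus, plus, opp; simpl.
    intros Ha. apply Rabs_def2 in Ha. lra.
  - exists 1. intros b Hb. exact Hb.
  - intros a b Ha Hb. apply H; lra.
Qed.

(** Cauchy's criterion: the integral of [f] between two bounds is at most the
    variation of [G], which tends to zero because [G] has limits at both ends. *)
Lemma RInt_gen_dominated_ex (f g G : R -> R) (la lb : R) :
  (forall t, 0 < t -> continuous f t) ->
  (forall t, 0 < t -> continuous g t) ->
  (forall t, 0 < t -> is_derive G t (g t)) ->
  (forall t, 0 < t -> Rabs (f t) <= g t) ->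
  filterlim G (at_right 0) (locally la) ->
  filterlim G (Rbar_locally p_infty) (locally lb) ->
  exists l, is_RInt_gen f (at_right 0) (Rbar_locally p_infty) l.
Proof.
  intros Cf Cg DG Hfg Hla Hlb.
  assert (ExF : forall a b, 0 < a -> 0 < b -> ex_RInt f a b).
  { intros a b Ha Hb. apply (ex_RInt_continuous (V := R_CompleteNormedModule)).
    intros z [Hz _]. apply Cf. revert Hz. unfold Rmin.
    destruct (Rle_dec a b); lra. }
  assert (Hpart : forall a b, 0 < a -> a <= b -> Rabs (RInt f a b) <= G b - G a).
  { intros a b Ha Hab.
    assert (HG : is_RInt g a b (G b - G a)).
    { apply (is_RInt_derive (V := R_CompleteNormedModule)).
      - intros t Ht. apply DG. rewrite Rmin_left in Ht; lra.
      - intros t Ht. apply Cg. rewrite Rmin_left in Ht; lra. }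
    apply (norm_RInt_le (V := R_NormedModule) f g a b); trivial.
    - intros t Ht. apply Hfg. lra.
    - apply (RInt_correct (V := R_CompleteNormedModule)). apply ExF; lra. }
  assert (Hpart' : forall a b, 0 < a -> 0 < b -> Rabs (RInt f a b) <= Rabs (G b - G a)).
  { intros a b Ha Hb. destruct (Rle_dec a b) as [h|h].
    - eapply Rle_trans; [apply Hpart; lra|apply Rle_abs].
    - rewrite <- (opp_RInt_swap (V := R_CompleteNormedModule) f b a) by (apply ExF; lra).
      change (opp (RInt f b a)) with (- RInt f b a).
      rewrite Rabs_Ropp, Rabs_minus_sym.
      eapply Rle_trans; [apply Hpart; lra|apply Rle_abs]. }
  assert (HC : exists y : R, filterlim (fun ab : R * R => RInt f (fst ab) (snd ab))
      (filter_prod (at_right 0) (Rbar_locally p_infty)) (locally y)).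
  { apply (filterlim_locally_cauchy (U := R_CompleteSpace)).
    intros eps.
    assert (e4 : 0 < eps / 4) by (destruct eps; simpl; lra).
    exists (fun ab : R * R => 0 < fst ab /\ 0 < snd ab /\
       Rabs (G (fst ab) - la) < eps / 4 /\ Rabs (G (snd ab) - lb) < eps / 4).
    split.
    - apply Filter_prod with (fun a => 0 < a /\ Rabs (G a - la) < eps / 4)
         (fun b => 0 < b /\ Rabs (G b - lb) < eps / 4).
      + apply filter_and.
        * exists (mkposreal 1 Rlt_0_1). intros a _ Ha; exact Ha.
        * apply (Hla (fun y => Rabs (y - la) < eps / 4)).
          exists (mkposreal _ e4). intros y Hy. exact Hy.
      + apply filter_and.
        * exists 0. intros a Ha; exact Ha.
        * apply (Hlb (fun y => Rabs (y - lb) < eps / 4)).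
          exists (mkposreal _ e4). intros y Hy. exact Hy.
      + intros a b Ha Hb; simpl; tauto.
    - intros [a b] [a' b'] (Ha & Hb & H1 & H2) (Ha' & Hb' & H1' & H2'); simpl in *.
      change (Rabs (RInt f a' b' - RInt f a b) < eps).
      assert (E : RInt f a' b' - RInt f a b = RInt f a' a + RInt f b b').
      { pose proof (RInt_Chasles (V := R_CompleteNormedModule) f a' a b (ExF _ _ Ha' Ha) (ExF _ _ Ha Hb)) as E1.
        pose proof (RInt_Chasles (V := R_CompleteNormedModule) f a' b b' (ExF _ _ Ha' Hb) (ExF _ _ Hb Hb')) as E2.
        change (RInt f a' a + RInt f a b = RInt f a' b) in E1.
        change (RInt f a' b + RInt f b b' = RInt f a' b') in E2. lra. }
      rewrite E. eapply Rle_lt_trans; [apply Rabs_triang|].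
      pose proof (Hpart' a' a Ha' Ha). pose proof (Hpart' b b' Hb Hb').
      assert (Rabs (G a - G a') < eps / 2).
      { replace (G a - G a') with ((G a - la) - (G a' - la)) by ring.
        eapply Rle_lt_trans; [apply Rabs_triang|]. rewrite Rabs_Ropp. lra. }
      assert (Rabs (G b' - G b) < eps / 2).
      { replace (G b' - G b) with ((G b' - lb) - (G b - lb)) by ring.
        eapply Rle_lt_trans; [apply Rabs_triang|]. rewrite Rabs_Ropp. lra. }
      lra. }
  destruct HC as [y Hy]. exists y.
  refine (filterlimi_lim_ext_loc _ _ _ Hy).
  apply filter_prod_pos. intros a b Ha _ Hb. simpl.
  apply (RInt_correct (V := R_CompleteNormedModule)). apply ExF; lra.
Qed.

Lemma exp_pow_INR (y : R) (n : nat) : exp y ^ n = exp (y * INR n).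
Proof.
  rewrite <- Rpower_pow by apply exp_pos. unfold Rpower. rewrite ln_exp. f_equal; ring.
Qed.

(** [t / q <= exp (t / q)] raised to the power [n], with [q] chosen so that the
    exponential produced stays below [exp (t / 2)]. *)
Lemma pow_exp_le (n : nat) (t : R) : 0 <= t ->
  t ^ n * exp (- t) <= (2 * (INR n + 1)) ^ n * exp (- t / 2).
Proof.
  intros Ht. pose proof (pos_INR n) as Hn.
  set (q := 2 * (INR n + 1)). assert (Hq : 0 < q) by (unfold q; lra).
  assert (H1 : t <= q * exp (t / q)).
  { pose proof (exp_ineq1_le (t / q)). replace t with (q * (t / q)) at 1 by (field; lra).
    apply Rmult_le_compat_l; lra. }
  assert (H2 : t ^ n <= q ^ n * exp (t / 2)).
  { apply Rle_trans with ((q * exp (t / q)) ^ n).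
    - apply pow_incr. lra.
    - rewrite Rpow_mult_distr. apply Rmult_le_compat_l; [apply pow_le; lra|].
      rewrite exp_pow_INR.
      assert (H : t / q * INR n <= t / 2).
      { apply Rmult_le_reg_r with q; [lra|]. unfold q. field_simplify; nra. }
      destruct H as [H|H]; [left; apply exp_increasing, H|right; now rewrite H]. }
  replace (exp (- t / 2)) with (exp (t / 2) * exp (- t)) by (rewrite <- exp_plus; f_equal; field).
  rewrite <- Rmult_assoc. apply Rmult_le_compat_r; [left; apply exp_pos|exact H2].
Qed.

Lemma filterlim_expl_0 : filterlim (fun t => exp (- t / 2)) (at_right 0) (locally 1).
Proof.
  apply (filterlim_filter_le_1 (F := locally 0) (G := at_right 0)).
  { apply filter_le_within. }
  replace 1 with (exp (- 0 / 2)) by (replace (-0/2) with 0 by field; apply exp_0).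
  apply (continuous_comp (fun t => - t / 2) exp).
  - apply (ex_derive_continuous (fun t => - t / 2)). auto_derive; trivial.
  - apply continuous_exp.
Qed.

Lemma filterlim_expl_oo :
  filterlim (fun t => exp (- t / 2)) (Rbar_locally p_infty) (locally 0).
Proof.
  apply (is_lim_comp exp (fun t => - t / 2) p_infty 0 m_infty).
  - apply is_lim_exp_m.
  - apply is_lim_ext with (fun t => (- / 2) * t). { intros; field. }
    replace m_infty with (Rbar_mult (- / 2) p_infty).
    + apply is_lim_scal_l. apply is_lim_id.
    + simpl. destruct (Rle_dec 0 (- / 2)); [exfalso; lra|]. reflexivity.
  - exists 0. intros; discriminate.
Qed.

Lemma gamma_integral_ex (n : nat) (u : R -> R) :
  (forall t, 0 < t -> continuous u t) -> (forall t, Rabs (u t) <= 1) ->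
  exists l, is_RInt_gen (fun t => t ^ n * exp (- t) * u t)
              (at_right 0) (Rbar_locally p_infty) l.
Proof.
  intros Cu Hu.
  set (K := (2 * (INR n + 1)) ^ n).
  apply RInt_gen_dominated_ex with (g := fun t => K * exp (- t / 2))
    (G := fun t => (-2 * K) * exp (- t / 2)) (la := (-2 * K) * 1) (lb := (-2 * K) * 0).
  - intros t Ht. apply (continuous_mult (fun t => t ^ n * exp (- t)) u); [|now apply Cu].
    apply (ex_derive_continuous (fun t => t ^ n * exp (- t))). auto_derive; trivial.
  - intros t Ht.
    apply (ex_derive_continuous (fun t => K * exp (- t / 2))). auto_derive; trivial.
  - intros t Ht. auto_derive; trivial. unfold Rdiv. field.
  - intros t Ht. rewrite Rabs_mult, Rabs_pos_eq.
    + pose proof (pow_exp_le n t (Rlt_le _ _ Ht)). fold K in H.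
      rewrite <- (Rmult_1_r (K * _)).
      apply Rmult_le_compat; trivial.
      * apply Rmult_le_pos; [apply pow_le; lra|left; apply exp_pos].
      * apply Rabs_pos.
    + apply Rmult_le_pos; [apply pow_le; lra|left; apply exp_pos].
  - apply (filterlim_comp _ _ _ (fun t => exp (- t / 2)) (fun y => -2 * K * y) _ (locally 1)).
    + apply filterlim_expl_0.
    + apply (continuous_scal_r (V := R_NormedModule) (-2*K) (fun y => y)). apply continuous_id.
  - apply (filterlim_comp _ _ _ (fun t => exp (- t / 2)) (fun y => -2 * K * y) _ (locally 0)).
    + apply filterlim_expl_oo.
    + apply (continuous_scal_r (V := R_NormedModule) (-2*K) (fun y => y)). apply continuous_id.
Qed.

(** * The functional equation of the Gamma function *)

Local Notation is_RInt_pos f l := (is_RInt_gen (V := R_NormedModule) f (at_right 0) (Rbar_locally p_infty) l).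

Lemma continuous_cos_ln (nu t : R) : 0 < t -> continuous (fun t => cos (nu * ln t)) t.
Proof.
  intros Ht. apply (ex_derive_continuous (fun t => cos (nu * ln t))). auto_derive; trivial.
Qed.

Lemma continuous_sin_ln (nu t : R) : 0 < t -> continuous (fun t => sin (nu * ln t)) t.
Proof.
  intros Ht. apply (ex_derive_continuous (fun t => sin (nu * ln t))). auto_derive; trivial.
Qed.

Lemma Rabs_cos_le (x : R) : Rabs (cos x) <= 1.
Proof. apply Rabs_le, COS_bound. Qed.

Lemma Rabs_sin_le (x : R) : Rabs (sin x) <= 1.
Proof. apply Rabs_le, SIN_bound. Qed.

(** The real and imaginary parts of [Gamma (1 + i nu + n)], as real integrals. *)
Definition gammaC (n : nat) (nu : R) : R :=
  RInt_gen (fun t => t ^ n * exp (- t) * cos (nu * ln t))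
    (at_right 0) (Rbar_locally p_infty).

Definition gammaS (n : nat) (nu : R) : R :=
  RInt_gen (fun t => t ^ n * exp (- t) * sin (nu * ln t))
    (at_right 0) (Rbar_locally p_infty).

Lemma gammaC_correct (n : nat) (nu : R) :
  is_RInt_pos (fun t => t ^ n * exp (- t) * cos (nu * ln t)) (gammaC n nu).
Proof.
  apply (RInt_gen_correct (V := R_CompleteNormedModule)).
  destruct (gamma_integral_ex n (fun t => cos (nu * ln t))) as [l Hl].
  - intros; now apply continuous_cos_ln.
  - intros; apply Rabs_cos_le.
  - exists l; exact Hl.
Qed.

Lemma gammaS_correct (n : nat) (nu : R) :
  is_RInt_pos (fun t => t ^ n * exp (- t) * sin (nu * ln t)) (gammaS n nu).
Proof.
  apply (RInt_gen_correct (V := R_CompleteNormedModule)).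
  destruct (gamma_integral_ex n (fun t => sin (nu * ln t))) as [l Hl].
  - intros; now apply continuous_sin_ln.
  - intros; apply Rabs_sin_le.
  - exists l; exact Hl.
Qed.

Lemma is_RInt_pos_unique (f : R -> R) (l l' : R) : is_RInt_pos f l -> is_RInt_pos f l' -> l = l'.
Proof.
  intros H H'.
  rewrite <- (is_RInt_gen_unique (V := R_CompleteNormedModule) f l H).
  apply (is_RInt_gen_unique (V := R_CompleteNormedModule)), H'.
Qed.

Lemma is_RInt_pos_ext (f g : R -> R) (l : R) :
  (forall t, 0 < t -> f t = g t) -> is_RInt_pos f l -> is_RInt_pos g l.
Proof.
  intros H. apply is_RInt_gen_ext. apply filter_prod_pos.
  intros a b Ha Ha1 Hb1 t Ht. simpl in Ht. apply H. rewrite Rmin_left in Ht; lra.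
Qed.

Lemma gamma_boundary_0 (n : nat) (u : R -> R) : (forall t, Rabs (u t) <= 1) ->
  filterlim (fun t => t ^ S n * exp (- t) * u t) (at_right 0) (locally 0).
Proof.
  intros Hu. apply filterlim_locally. intros eps.
  assert (He : 0 < Rmin 1 eps) by (apply Rmin_pos; [lra|apply cond_pos]).
  exists (mkposreal _ He). intros t Ht Ht0.
  assert (Ht1 : t < Rmin 1 eps).
  { change (Rabs (t - 0) < Rmin 1 eps) in Ht. apply Rabs_def2 in Ht. lra. }
  pose proof (Rmin_l 1 eps). pose proof (Rmin_r 1 eps).
  change (Rabs (t ^ S n * exp (- t) * u t - 0) < eps).
  rewrite Rminus_0_r, Rabs_mult.
  assert (H1 : 0 <= t ^ n <= 1).
  { split; [apply pow_le; lra|]. rewrite <- (pow1 n). apply pow_incr; lra. }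
  assert (H2 : 0 < exp (- t) <= 1).
  { split; [apply exp_pos|]. rewrite <- exp_0. left. apply exp_increasing. lra. }
  rewrite Rabs_pos_eq.
  2:{ apply Rmult_le_pos; [apply pow_le|]; lra. }
  pose proof (Hu t). pose proof (Rabs_pos (u t)).
  apply Rle_lt_trans with t; [|lra]. simpl.
  assert (H5 : 0 <= t * t ^ n * exp (- t) <= t).
  { assert (0 <= t ^ n * exp (- t) <= 1).
    { split; [apply Rmult_le_pos; lra|]. rewrite <- (Rmult_1_l 1).
      apply Rmult_le_compat; lra. }
    rewrite Rmult_assoc. nra. }
  nra.
Qed.

Lemma gamma_boundary_oo (n : nat) (u : R -> R) : (forall t, Rabs (u t) <= 1) ->
  filterlim (fun t => t ^ n * exp (- t) * u t) (Rbar_locally p_infty) (locally 0).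
Proof.
  intros Hu. set (K := (2 * (INR n + 1)) ^ n).
  assert (L : filterlim (fun t => K * exp (- t / 2)) (Rbar_locally p_infty) (locally 0)).
  { replace (locally (T:=R_UniformSpace) 0) with (locally (T:=R_UniformSpace) (K * 0)) by (f_equal; ring).
    apply (filterlim_comp _ _ _ (fun t => exp (- t / 2)) (fun y => K * y) _ (locally 0)).
    + apply filterlim_expl_oo.
    + apply (continuous_scal_r (V := R_NormedModule) K (fun y => y)). apply continuous_id. }
  apply filterlim_locally. intros eps.
  generalize (proj1 (filterlim_locally _ _) L eps). intros [M HM].
  exists (Rmax M 0). intros t Ht.
  pose proof (Rmax_l M 0). pose proof (Rmax_r M 0).
  assert (Ht' : M < t) by lra. specialize (HM t Ht').
  change (Rabs (K * exp (- t / 2) - 0) < eps) in HM.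
  change (Rabs (t ^ n * exp (- t) * u t - 0) < eps).
  rewrite Rminus_0_r in *.
  apply Rabs_def2 in HM. rewrite Rabs_mult.
  pose proof (pow_exp_le n t ltac:(lra)) as H1. fold K in H1.
  pose proof (Hu t). pose proof (Rabs_pos (u t)).
  assert (0 <= t ^ n * exp (- t)).
  { apply Rmult_le_pos; [apply pow_le; lra|left; apply exp_pos]. }
  rewrite Rabs_pos_eq by trivial. nra.
Qed.

(** Integration by parts in the only form needed: a function vanishing at both ends
    has a derivative of zero integral. *)
Lemma is_RInt_pos_derivative (f df : R -> R) :
  (forall t, 0 < t -> is_derive f t (df t)) ->
  (forall t, 0 < t -> continuous df t) ->
  filterlim f (at_right 0) (locally 0) ->
  filterlim f (Rbar_locally p_infty) (locally 0) ->
  is_RInt_pos df 0.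
Proof.
  intros D C H0 Hoo.
  apply is_RInt_pos_ext with (Derive f).
  { intros t Ht. apply is_derive_unique, D, Ht. }
  cut (is_RInt_pos (Derive f) (0 - 0)); [now rewrite Rminus_0_r|].
  assert (Q : forall a b t : R, 0 < a -> 0 < b -> Rmin a b <= t -> 0 < t).
  { intros a b t Ha Hb. unfold Rmin. destruct (Rle_dec a b); lra. }
  apply is_RInt_gen_Derive; trivial.
  - apply filter_prod_pos. intros a b Ha Ha1 Hb1 t Ht. simpl in Ht.
    exists (df t). apply D. apply (Q a b); lra.
  - apply filter_prod_pos. intros a b Ha Ha1 Hb1 t Ht. simpl in Ht.
    assert (Ht0 : 0 < t) by (apply (Q a b); lra).
    apply continuous_ext_loc with df; [|now apply C].
    exists (mkposreal t Ht0). intros y Hy. symmetry. apply is_derive_unique, D.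
    change (Rabs (y - t) < t) in Hy. apply Rabs_def2 in Hy. lra.
Qed.

Ltac unfold_ops :=
  unfold minus, scal, plus, opp; cbn -[INR pow fact];
  unfold mult; cbn -[INR pow fact].

(** The derivative of [t^(n+1) e^-t cos (nu ln t)] is the difference of the
    integrands of both sides.  This and the next lemma are the two components of
    [Gamma (z + 1) = z Gamma (z)]. *)
Lemma gammaC_succ (n : nat) (nu : R) :
  gammaC (S n) nu = INR (S n) * gammaC n nu - nu * gammaS n nu.
Proof.
  pose proof (gammaC_correct (S n) nu) as H1.
  pose proof (is_RInt_gen_scal (V := R_NormedModule) _ (INR (S n)) _ (gammaC_correct n nu)) as H2.
  pose proof (is_RInt_gen_scal (V := R_NormedModule) _ nu _ (gammaS_correct n nu)) as H3.
  pose proof (is_RInt_gen_minus (V := R_NormedModule) _ _ _ _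
    (is_RInt_gen_minus (V := R_NormedModule) _ _ _ _ H2 H3) H1) as H4.
  cut (INR (S n) * gammaC n nu - nu * gammaS n nu - gammaC (S n) nu = 0); [lra|].
  apply (is_RInt_pos_unique _ _ _ H4).
  apply is_RInt_pos_derivative with (fun t => t ^ S n * exp (- t) * cos (nu * ln t)).
  - intros t Ht. auto_derive; [exact Ht|].
    change (match n with 0%nat => 1 | S _ => INR n + 1 end) with (INR (S n)).
    unfold_ops. rewrite S_INR. simpl pow. field. lra.
  - intros t Ht. apply (ex_derive_continuous (V := R_NormedModule)).
    unfold_ops.
    auto_derive. tauto.
  - apply gamma_boundary_0. intros; apply Rabs_cos_le.
  - apply gamma_boundary_oo. intros; apply Rabs_cos_le.
Qed.

Lemma gammaS_succ (n : nat) (nu : R) :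
  gammaS (S n) nu = INR (S n) * gammaS n nu + nu * gammaC n nu.
Proof.
  pose proof (gammaS_correct (S n) nu) as H1.
  pose proof (is_RInt_gen_scal (V := R_NormedModule) _ (INR (S n)) _ (gammaS_correct n nu)) as H2.
  pose proof (is_RInt_gen_scal (V := R_NormedModule) _ nu _ (gammaC_correct n nu)) as H3.
  pose proof (is_RInt_gen_minus (V := R_NormedModule) _ _ _ _
    (is_RInt_gen_plus (V := R_NormedModule) _ _ _ _ H2 H3) H1) as H4.
  cut (INR (S n) * gammaS n nu + nu * gammaC n nu - gammaS (S n) nu = 0); [lra|].
  apply (is_RInt_pos_unique _ _ _ H4).
  apply is_RInt_pos_derivative with (fun t => t ^ S n * exp (- t) * sin (nu * ln t)).
  - intros t Ht. auto_derive; [exact Ht|].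
    change (match n with 0%nat => 1 | S _ => INR n + 1 end) with (INR (S n)).
    unfold_ops. rewrite S_INR. simpl pow. field. lra.
  - intros t Ht. apply (ex_derive_continuous (V := R_NormedModule)).
    unfold_ops.
    auto_derive. tauto.
  - apply gamma_boundary_0. intros; apply Rabs_sin_le.
  - apply gamma_boundary_oo. intros; apply Rabs_sin_le.
Qed.

(** The functional equation at [nu = 0], started from [Gamma (1) = 1]. *)
Lemma is_RInt_pos_moment (n : nat) : is_RInt_pos (fun t => t ^ n * exp (- t)) (INR (fact n)).
Proof.
  assert (G0 : gammaC 0 0 = 1).
  { apply (is_RInt_pos_unique (fun t => t ^ 0 * exp (- t) * cos (0 * ln t))); [apply gammaC_correct|].
    apply is_RInt_pos_ext with (Derive (fun t => - exp (- t))).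
    { intros t _. rewrite Rmult_0_l, cos_0.
      apply is_derive_unique. auto_derive; trivial. simpl; ring. }
    cut (is_RInt_pos (Derive (fun t => - exp (- t))) (0 - -1)); [now replace (0 - -1) with 1 by ring|].
    apply is_RInt_gen_Derive.
    - apply filter_prod_pos. intros. auto_derive; trivial.
    - apply filter_prod_pos. intros a b _ _ _ t _.
      apply continuous_ext with (fun t => exp (- t)).
      { intros y. symmetry. apply is_derive_unique. auto_derive; trivial. ring. }
      apply (ex_derive_continuous (fun t => exp (- t))). auto_derive; trivial.
    - apply (filterlim_filter_le_1 (F := locally 0) (G := at_right 0)).
      { apply filter_le_within. }
      replace (locally (T:=R_UniformSpace) (-1)) with (locally (T:=R_UniformSpace) (- exp (- 0)))
        by (f_equal; rewrite Ropp_0, exp_0; reflexivity).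
      apply (ex_derive_continuous (fun t => - exp (- t))). auto_derive; trivial.
    - pose proof (gamma_boundary_oo 0 (fun _ => -1)) as H.
      eapply filterlim_ext; [|apply H].
      + intros t; simpl; ring.
      + intros; rewrite Rabs_left; lra. }
  assert (G : forall n, gammaC n 0 = INR (fact n)).
  { clear n. induction n as [|n IH]; [rewrite G0; reflexivity|].
    rewrite gammaC_succ, IH, Rmult_0_l, Rminus_0_r, fact_simpl, mult_INR. reflexivity. }
  rewrite <- G. eapply is_RInt_pos_ext; [|apply gammaC_correct].
  intros t _. simpl. rewrite Rmult_0_l, cos_0. ring.
Qed.

(** * Gamma far to the right of the imaginary axis *)

Lemma is_RInt_gen_pair (f : R -> C) (lu lv : R) :
  is_RInt_pos (fun t => fst (f t)) lu -> is_RInt_pos (fun t => snd (f t)) lv ->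
  is_RInt_gen (V := C_R_CompleteNormedModule) f (at_right 0) (Rbar_locally p_infty) (lu, lv).
Proof.
  intros Hu Hv P [eps HP].
  assert (Hu' := Hu _ (locally_ball (lu : R_UniformSpace) eps)).
  assert (Hv' := Hv _ (locally_ball (lv : R_UniformSpace) eps)).
  unfold filtermapi in *.
  generalize (filter_and _ _ Hu' Hv'). apply filter_imp.
  intros [a b] [[yu [H1 H2]] [yv [H3 H4]]]. exists (yu, yv). split.
  - apply (is_RInt_fct_extend_pair (U := R_NormedModule) (V := R_NormedModule)); assumption.
  - apply HP. split; assumption.
Qed.

Definition Gm (n : nat) (nu : R) : C := (gammaC n nu, gammaS n nu).

Lemma Gamma_Gm (nu : R) (k : nat) : Gamma (1 + Ci * nu + INR k) = Gm k nu.
Proof.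
  unfold Gamma.
  apply (is_RInt_gen_unique (V := C_R_CompleteNormedModule)).
  assert (E : (1 + Ci * nu + INR k - 1)%C = (INR k, nu)).
  { apply injective_projections; simpl; ring. }
  rewrite E.
  apply is_RInt_gen_pair.
  - eapply is_RInt_pos_ext; [|apply gammaC_correct]. intros t Ht.
    unfold rcpow. simpl. rewrite Rpower_pow by trivial. ring.
  - eapply is_RInt_pos_ext; [|apply gammaS_correct]. intros t Ht.
    unfold rcpow. simpl. rewrite Rpower_pow by trivial. ring.
Qed.

(** Both [ln u <= u - 1] and [- ln u <= 1/u - 1], combined with
    [a <= d/2 + a^2/(2d)].  The right-hand side is a combination of powers of [u], so
    its mean under a Gamma weight is explicit, while that of [|ln u|] is not. *)
Lemma Rabs_ln_le (u d : R) : 0 < u -> 0 < d ->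
  Rabs (ln u) <= d / 2 + ((u - 1) ^ 2 + (/ u - 1) ^ 2) / (2 * d).
Proof.
  intros Hu Hd.
  assert (Hln : forall v, 0 < v -> ln v <= v - 1).
  { intros v Hv. pose proof (exp_ineq1_le (ln v)) as H. rewrite exp_ln in H; lra. }
  assert (A : forall a, a <= d / 2 + a ^ 2 / (2 * d)).
  { intros a. apply Rmult_le_reg_r with (2 * d); [lra|].
    replace ((d / 2 + a ^ 2 / (2 * d)) * (2 * d)) with (d ^ 2 + a ^ 2) by (field; lra).
    pose proof (pow2_ge_0 (d - a)). lra. }
  assert (P : forall a, 0 <= a ^ 2 / (2 * d)).
  { intros a. apply Rdiv_le_0_compat; [apply pow2_ge_0|lra]. }
  pose proof (Hln u Hu). pose proof (Hln (/ u) (Rinv_0_lt_compat _ Hu)) as H1.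
  rewrite ln_Rinv in H1 by trivial.
  pose proof (A (u - 1)). pose proof (A (/ u - 1)).
  pose proof (P (u - 1)). pose proof (P (/ u - 1)).
  rewrite Rdiv_plus_distr. apply Rabs_le. lra.
Qed.

Lemma is_RInt_pos_norm_le (f g : R -> R) (lf lg : R) :
  (forall t, 0 < t -> Rabs (f t) <= g t) -> is_RInt_pos f lf -> is_RInt_pos g lg -> Rabs lf <= lg.
Proof.
  intros H Hf Hg.
  refine (RInt_gen_norm (V := R_CompleteNormedModule) _ _ _ _ _ _ Hf Hg).
  - apply filter_prod_pos. intros a b Ha Ha1 Hb1. simpl. lra.
  - apply filter_prod_pos. intros a b Ha Ha1 Hb1 t Ht. simpl in Ht. apply H. lra.
Qed.

(** Under the probability weight [t^N e^-t / N!] the means of [(t/N - 1)^2] and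
    [(N/t - 1)^2] are [(N+2)/N^2] and [1/(N-1)].  So a function that oscillates
    slowly in [ln t] has nearly its value at [N] as mean; the parameter [d] of
    [Rabs_ln_le] is taken to be [1/sqrt N], which balances its two terms. *)
Lemma gamma_weight_concentration (N : nat) (u : R -> R) (v nu l : R) :
  (2 <= N)%nat -> 0 <= nu ->
  (forall t, 0 < t -> Rabs (u t - v) <= nu * Rabs (ln (t / INR N))) ->
  is_RInt_pos (fun t => t ^ N * exp (- t) * u t) l ->
  Rabs (l / INR (fact N) - v) <= 3 * nu / sqrt (INR N).
Proof.
  intros HN Hnu Hu Hl.
  destruct N as [|[|k]]; [lia|lia|]. clear HN.
  set (N := S (S k)) in *. set (n := INR N).
  assert (Hn : 2 <= n). { unfold n, N. rewrite !S_INR. pose proof (pos_INR k). lra. }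
  set (s := sqrt n).
  assert (Hs : s * s = n) by (apply sqrt_sqrt; lra).
  assert (Hs0 : 0 < s) by (apply sqrt_lt_R0; lra).
  set (F := INR (fact N)).
  assert (HF : 0 < F) by apply INR_fact_lt_0.
  assert (F1 : INR (fact (S N)) = (n + 1) * F).
  { rewrite fact_simpl, mult_INR, S_INR. reflexivity. }
  assert (F2 : INR (fact (S (S N))) = (n + 2) * (n + 1) * F).
  { rewrite fact_simpl, mult_INR, F1, !S_INR. unfold n. ring. }
  assert (G1 : INR (fact (S k)) = F / n).
  { unfold F, N. rewrite (fact_simpl (S k)), mult_INR. fold N. fold n. field. lra. }
  assert (G2 : INR (fact k) = F / (n * (n - 1))).
  { replace (INR (fact k)) with (INR (fact (S k)) / (n - 1)); [rewrite G1; field; lra|].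
    rewrite (fact_simpl k), mult_INR.
    replace (INR (S k)) with (n - 1) by (unfold n, N; rewrite (S_INR (S k)); ring).
    field. lra. }
  (* M0, M1, M2, P1, P2 are the moments of order N, N+1, N+2, N-1, N-2; their
     combination T integrates the bound of Rabs_ln_le against the weight *)
  pose proof (is_RInt_pos_moment N) as M0. pose proof (is_RInt_pos_moment (S N)) as M1.
  pose proof (is_RInt_pos_moment (S (S N))) as M2. pose proof (is_RInt_pos_moment k) as P2.
  pose proof (is_RInt_pos_moment (S k)) as P1.
  rewrite F1 in M1. rewrite F2 in M2. rewrite G1 in P1. rewrite G2 in P2. fold F in M0.
  apply (is_RInt_gen_scal (V := R_NormedModule) _ (nu * (/ s / 2 + s))) in M0 as T0.
  apply (is_RInt_gen_scal (V := R_NormedModule) _ (nu * (- s / n))) in M1 as T1.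
  apply (is_RInt_gen_scal (V := R_NormedModule) _ (nu * (s / 2 / n ^ 2))) in M2 as T2.
  apply (is_RInt_gen_scal (V := R_NormedModule) _ (nu * (- s * n))) in P1 as T3.
  apply (is_RInt_gen_scal (V := R_NormedModule) _ (nu * (s / 2 * n ^ 2))) in P2 as T4.
  pose proof (is_RInt_gen_plus (V := R_NormedModule) _ _ _ _ T0
   (is_RInt_gen_plus (V := R_NormedModule) _ _ _ _ T1
    (is_RInt_gen_plus (V := R_NormedModule) _ _ _ _ T2
     (is_RInt_gen_plus (V := R_NormedModule) _ _ _ _ T3 T4)))) as T.
  clear T0 T1 T2 T3 T4.
  pose proof (is_RInt_gen_minus (V := R_NormedModule) _ _ _ _ Hl
     (is_RInt_gen_scal (V := R_NormedModule) _ v _ M0)) as D.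
  pose proof (fun H => is_RInt_pos_norm_le _ _ _ _ H D T) as B.
  match type of B with ?X -> _ => assert (B0 : X) end.
  { intros t Ht0.
    change (Rabs ((t ^ N * exp (- t) * u t) - v * (t ^ N * exp (- t))) <=
      nu * (/ s / 2 + s) * (t ^ N * exp (- t)) + (nu * (- s / n) * (t ^ S N * exp (- t))
      + (nu * (s / 2 / n ^ 2) * (t ^ S (S N) * exp (- t))
      + (nu * (- s * n) * (t ^ S k * exp (- t)) + nu * (s / 2 * n ^ 2) * (t ^ k * exp (- t)))))).
    set (w := t ^ N * exp (- t)).
    assert (Hw : 0 <= w).
    { apply Rmult_le_pos; [apply pow_le; lra|left; apply exp_pos]. }
    replace (w * u t - v * w) with (w * (u t - v)) by ring.
    rewrite Rabs_mult, (Rabs_pos_eq w) by trivial.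
    assert (Htn : 0 < t / n) by (apply Rdiv_lt_0_compat; lra).
    pose proof (Rabs_ln_le (t / n) (/ s) Htn (Rinv_0_lt_compat _ Hs0)) as Hln.
    apply Rle_trans with (w * (nu * (/ s / 2 + ((t / n - 1) ^ 2 + (/ (t / n) - 1) ^ 2) / (2 * / s)))).
    { apply Rmult_le_compat_l; trivial. eapply Rle_trans; [apply Hu; trivial|].
      apply Rmult_le_compat_l; trivial. }
    right. unfold w, N. simpl. field. repeat split; lra. }
  specialize (B B0). clear B0.
  change (Rabs (l - v * F) <=
     nu * (/ s / 2 + s) * F + (nu * (- s / n) * ((n + 1) * F)
     + (nu * (s / 2 / n ^ 2) * ((n + 2) * (n + 1) * F)
     + (nu * (- s * n) * (F / n) + nu * (s / 2 * n ^ 2) * (F / (n * (n - 1))))))) in B.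
  replace (l / F - v) with ((l - v * F) / F) by (field; lra).
  unfold Rdiv at 1. rewrite Rabs_mult, (Rabs_pos_eq (/ F)) by (left; now apply Rinv_0_lt_compat).
  apply Rmult_le_reg_r with F; trivial. rewrite Rmult_assoc, Rinv_l, Rmult_1_r by lra.
  eapply Rle_trans; [exact B|].
  replace (nu * (/ s / 2 + s) * F + (nu * (- s / n) * ((n + 1) * F)
     + (nu * (s / 2 / n ^ 2) * ((n + 2) * (n + 1) * F)
     + (nu * (- s * n) * (F / n) + nu * (s / 2 * n ^ 2) * (F / (n * (n - 1)))))))
   with (nu * F * / s * (1 / 2 + s * s / 2 * ((n + 2) / n ^ 2 + / (n - 1)))) by (field; repeat split; lra).
  rewrite Hs.
  assert (Hb : n / 2 * ((n + 2) / n ^ 2 + / (n - 1)) <= 2).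
  { apply Rmult_le_reg_r with (2 * n * (n - 1)); [nra|].
    replace (n / 2 * ((n + 2) / n ^ 2 + / (n - 1)) * (2 * n * (n - 1)))
      with ((n + 2) * (n - 1) + n * n) by (field; lra). nra. }
  replace (3 * nu / s * F) with (nu * F * / s * 3) by (field; lra).
  apply Rmult_le_compat_l; [|lra].
  apply Rmult_le_pos; [apply Rmult_le_pos; lra|left; now apply Rinv_0_lt_compat].
Qed.

(** * One step of Stirling's series *)

(** Derivative of a complex function of a real variable, by components; the
    mean value bound below reduces to the real one on each component. *)
Definition Cder (f : R -> C) (t : R) (d : C) : Prop :=
  is_derive (fun u => fst (f u)) t (fst d) /\ is_derive (fun u => snd (f u)) t (snd d).

Lemma Cder_plus (f g : R -> C) (t : R) (df dg : C) :
  Cder f t df -> Cder g t dg -> Cder (fun u => f u + g u)%C t (df + dg)%C.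
Proof.
  intros [F1 F2] [G1 G2]; split.
  - apply (is_derive_plus (V := R_NormedModule) _ _ _ _ _ F1 G1).
  - apply (is_derive_plus (V := R_NormedModule) _ _ _ _ _ F2 G2).
Qed.

Lemma Cder_monomial (c : C) (k : nat) (t : R) :
  Cder (fun u => RtoC (u ^ S k / INR (S k)) * c)%C t (RtoC (t ^ k) * c)%C.
Proof.
  assert (H : INR (S k) <> 0) by (apply not_0_INR; lia).
  split; cbn -[INR pow].
  - apply is_derive_ext with (fun u => u ^ S k / INR (S k) * fst c).
    { intros u. change (u ^ S k / INR (S k) * fst c = u ^ S k / INR (S k) * fst c - 0 * snd c). ring. }
    auto_derive; trivial.
    change (match k with 0%nat => 1 | S _ => INR k + 1 end) with (INR (S k)).
    cbn -[INR pow]. field. exact H.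
  - apply is_derive_ext with (fun u => u ^ S k / INR (S k) * snd c).
    { intros u. change (u ^ S k / INR (S k) * snd c = u ^ S k / INR (S k) * snd c + 0 * fst c). ring. }
    auto_derive; trivial.
    change (match k with 0%nat => 1 | S _ => INR k + 1 end) with (INR (S k)).
    cbn -[INR pow]. field. exact H.
Qed.

Lemma im_le_Cmod (c : C) : Rabs (Im c) <= Cmod c.
Proof. eapply Rle_trans; [apply Rmax_r|apply (Rmax_Cmod c)]. Qed.

Lemma Cmod_le_abs (c : C) : Cmod c <= Rabs (Re c) + Rabs (Im c).
Proof.
  replace c with (RtoC (Re c) + Ci * RtoC (Im c))%C at 1.
  - eapply Rle_trans; [apply Cmod_triangle|].
    rewrite Cmod_mult, Cmod_Ci, !Cmod_R. lra.
  - destruct c as [a b]. apply injective_projections; simpl; ring.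
Qed.

Lemma Cder_mean_value (f df : R -> C) (D : R) :
  (forall t, -1 <= t <= 1 -> Cder f t (df t) /\ Cmod (df t) <= D) ->
  Cmod (f 1 - f 0)%C <= 2 * D.
Proof.
  intros H. eapply Rle_trans; [apply Cmod_le_abs|].
  assert (T : forall t, Rabs (t - 0) <= Rabs (1 - 0) -> -1 <= t <= 1).
  { intros t Ht. rewrite Rminus_0_r, (Rabs_pos_eq (1 - 0)) in Ht by lra.
    apply Rabs_le_between in Ht. lra. }
  assert (H1 : Rabs (fst (f 1) - fst (f 0)) <= D * Rabs (1 - 0)).
  { apply (bounded_variation (fun u => fst (f u)) (fun t => fst (df t))).
    intros t Ht. destruct (H t (T t Ht)) as [[D1 _] Hd]. split; [exact D1|].
    eapply Rle_trans; [apply re_le_Cmod|exact Hd]. }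
  assert (H2 : Rabs (snd (f 1) - snd (f 0)) <= D * Rabs (1 - 0)).
  { apply (bounded_variation (fun u => snd (f u)) (fun t => snd (df t))).
    intros t Ht. destruct (H t (T t Ht)) as [[_ D2] Hd]. split; [exact D2|].
    eapply Rle_trans; [apply im_le_Cmod|exact Hd]. }
  rewrite (Rabs_pos_eq (1 - 0)) in H1, H2 by lra.
  change (Rabs (fst (f 1) - fst (f 0)) + Rabs (snd (f 1) - snd (f 0)) <= 2 * D). lra.
Qed.

(** The principal logarithm of [s + i nu] for [nu > 0]; the argument is written with
    [atan (s / nu)] so that the formula is smooth across [s = 0]. *)
Definition zlog (nu s : R) : C := (ln (s ^ 2 + nu ^ 2) / 2, PI / 2 - atan (s / nu)).

Lemma zlog_derive (nu s t : R) : 0 < nu ->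
  Cder (fun u => zlog nu (s - u)) t (- / ((s - t)%R, nu))%C.
Proof.
  intros Hnu.
  assert (0 < (s - t) ^ 2 + nu ^ 2). { pose proof (pow2_ge_0 (s - t)). nra. }
  split; simpl.
  - auto_derive; [simpl in H; lra|]. field. simpl in H. lra.
  - auto_derive; [lra|]. unfold Rsqr. field. simpl in H. split; [lra|].
    lra.
Qed.

Lemma C_neq_0_im (a b : R) : b <> 0 -> ((a, b) : C) <> RtoC 0.
Proof. intros H E. apply H. now injection E. Qed.

Lemma Cmod_pair_sqr (a b : R) : Cmod (a, b) ^ 2 = a ^ 2 + b ^ 2.
Proof. rewrite Cmod2_alt. reflexivity. Qed.

Lemma Cmod_inv_le_half (nu s : R) : 2 <= nu -> Cmod (/ (s, nu)) <= / 2.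
Proof.
  intros Hnu.
  rewrite Cmod_inv by (apply C_neq_0_im; lra). apply Rinv_le_contravar; [lra|].
  pose proof (im_le_Cmod (s, nu)) as H. simpl in H.
  rewrite Rabs_pos_eq in H; lra.
Qed.

Lemma Cmod_one_sub_ge (a : C) (d : R) : Cmod a <= d -> 1 - d <= Cmod (1 - a)%C.
Proof.
  intros H. pose proof (Cmod_triangle (1 - a)%C a) as T.
  replace (1 - a + a)%C with (RtoC 1) in T by ring. rewrite Cmod_1 in T. lra.
Qed.

Lemma Cmod_neq_0 (a : C) : 0 < Cmod a -> a <> RtoC 0.
Proof. intros H E. rewrite E, Cmod_0 in H. lra. Qed.

(** Taylor's formula for [- log (1 - w)]: along [z - t], [0 <= t <= 1], the derivative
    of the difference is [- w^9 t^8 / (1 - t w)], of size at most [2 |w|^9]. *)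
Lemma zlog_step (nu s : R) : 2 <= nu ->
  let w := (/ (s, nu))%C in
  Cmod (zlog nu s - zlog nu (s - 1) - (w + w ^ 2 / 2 + w ^ 3 / 3 + w ^ 4 / 4 + w ^ 5 / 5
     + w ^ 6 / 6 + w ^ 7 / 7 + w ^ 8 / 8))%C <= 4 * Cmod w ^ 9.
Proof.
  intros Hnu w.
  set (m := fun k u => (RtoC (u ^ S k / INR (S k)) * w ^ S k)%C).
  set (f := fun u => (zlog nu (s - u) + m 0%nat u + m 1%nat u + m 2%nat u + m 3%nat u
     + m 4%nat u + m 5%nat u + m 6%nat u + m 7%nat u)%C).
  set (z := (s, nu) : C).
  assert (Hz : z <> 0) by (apply C_neq_0_im; lra).
  assert (Hw : Cmod w <= / 2) by (now apply Cmod_inv_le_half).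
  pose proof (Cmod_ge_0 w) as Hw0.
  assert (K : Cmod (f 1 - f 0)%C <= 2 * (2 * Cmod w ^ 9)).
  { apply Cder_mean_value with (df := fun t => (- / ((s - t)%R, nu) + RtoC (t ^ 0) * w ^ 1
      + RtoC (t ^ 1) * w ^ 2 + RtoC (t ^ 2) * w ^ 3 + RtoC (t ^ 3) * w ^ 4
      + RtoC (t ^ 4) * w ^ 5 + RtoC (t ^ 5) * w ^ 6 + RtoC (t ^ 6) * w ^ 7
      + RtoC (t ^ 7) * w ^ 8)%C).
    intros t Ht. split.
    - unfold f. repeat apply Cder_plus; try apply Cder_monomial.
      apply zlog_derive. lra.
    - assert (E1 : (((s - t)%R, nu) : C) = (z - RtoC t)%C).
      { apply injective_projections; simpl; ring. }
      assert (Ht1 : Cmod (RtoC t) <= 1).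
      { rewrite Cmod_R. apply Rabs_le. lra. }
      assert (Htw : Cmod (RtoC t * w)%C <= / 2).
      { rewrite Cmod_mult. pose proof (Cmod_ge_0 (RtoC t)). nra. }
      pose proof (Cmod_one_sub_ge _ _ Htw) as H1.
      assert (H2 : (1 - RtoC t * w)%C <> 0) by (apply Cmod_neq_0; lra).
      assert (H3 : (z - RtoC t)%C <> 0) by (rewrite <- E1; apply C_neq_0_im; lra).
      rewrite E1.
      replace (- / (z - RtoC t))%C with (- w / (1 - RtoC t * w))%C
        by (unfold w; fold z; field; split; assumption).
      rewrite !RtoC_pow.
      replace (- w / (1 - RtoC t * w) + RtoC t ^ 0 * w ^ 1 + RtoC t ^ 1 * w ^ 2
        + RtoC t ^ 2 * w ^ 3 + RtoC t ^ 3 * w ^ 4 + RtoC t ^ 4 * w ^ 5 + RtoC t ^ 5 * w ^ 6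
        + RtoC t ^ 6 * w ^ 7 + RtoC t ^ 7 * w ^ 8)%C
        with (- (w ^ 9 * RtoC t ^ 8 / (1 - RtoC t * w)))%C by (field; exact H2).
      rewrite Cmod_opp, Cmod_div, Cmod_mult, !Cmod_pow by exact H2.
      assert (P9 : 0 <= Cmod w ^ 9) by (apply pow_le; exact Hw0).
      assert (P8 : 0 <= Cmod (RtoC t) ^ 8 <= 1).
      { split; [apply pow_le, Cmod_ge_0|]. rewrite <- (pow1 8). apply pow_incr.
        split; [apply Cmod_ge_0|exact Ht1]. }
      apply Rmult_le_reg_r with (Cmod (1 - RtoC t * w)%C); [lra|].
      unfold Rdiv. rewrite Rmult_assoc, Rinv_l, Rmult_1_r by lra. nra. }
  replace (zlog nu s - zlog nu (s - 1) - (w + w ^ 2 / 2 + w ^ 3 / 3 + w ^ 4 / 4 + w ^ 5 / 5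
     + w ^ 6 / 6 + w ^ 7 / 7 + w ^ 8 / 8))%C with (- (f 1 - f 0))%C.
  - rewrite Cmod_opp. lra.
  - unfold f. rewrite Rminus_0_r. set (a := zlog nu s). set (b := zlog nu (s - 1)).
    unfold m. simpl INR. unfold Rdiv. rewrite !RtoC_mult, !RtoC_pow.
    rewrite !RtoC_inv by lra. rewrite ?RtoC_plus. field.
Qed.

Definition stirling_tail (z : C) : C :=
  (/ (12 * z) - / (360 * z ^ 3) + / (1260 * z ^ 5))%C.

(** Imaginary part of the truncated Stirling series of [log Gamma (1 + z)], without
    its real constant [ln (2 PI) / 2]. *)
Definition stirling_arg (nu s : R) : R :=
  Im (((s, nu) + / 2) * zlog nu s - (s, nu) + stirling_tail (s, nu))%C.

Lemma im_minus (a b : C) : Im (a - b) = Im a - Im b.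
Proof. reflexivity. Qed.

(** With the truncated logarithm inserted ([r] is its error), the increment of
    Stirling's series minus [log z] is rational in [w = 1/z].  It starts at [w^8]
    because the coefficients [1/12], [-1/360], [1/1260] cancel everything before. *)
Lemma stirling_step_identity (w a r : C) : w <> 0 -> (1 - w)%C <> 0 ->
  ((/ w + / 2) * a - / w + stirling_tail (/ w)
   - ((/ w - 1 + / 2) * (a - (w + w ^ 2 / 2 + w ^ 3 / 3 + w ^ 4 / 4 + w ^ 5 / 5
        + w ^ 6 / 6 + w ^ 7 / 7 + w ^ 8 / 8) - r) - (/ w - 1) + stirling_tail (/ w - 1))
   - a = (/ w - / 2) * r + w ^ 8 * (- (83) / 720 + 371 / 720 * w - 67 / 72 * w ^ 2
      + 5 / 6 * w ^ 3 - 41 / 112 * w ^ 4 + / 16 * w ^ 5) / (1 - w) ^ 5)%C.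
Proof.
  intros Hw H1. unfold stirling_tail.
  replace (/ (12 * / w) - / (360 * (/ w) ^ 3) + / (1260 * (/ w) ^ 5))%C
    with (w / 12 - w ^ 3 / 360 + w ^ 5 / 1260)%C by (field; exact Hw).
  assert (H2 : (/ w - 1)%C <> 0).
  { intros E. apply H1. replace (1 - w)%C with (w * (/ w - 1))%C by (field; exact Hw).
    rewrite E. ring. }
  set (v := (w / (1 - w))%C).
  assert (Hv : (/ w - 1)%C = (/ v)%C) by (unfold v; field; split; assumption).
  replace (/ (12 * (/ w - 1)) - / (360 * (/ w - 1) ^ 3) + / (1260 * (/ w - 1) ^ 5))%C
    with (v / 12 - v ^ 3 / 360 + v ^ 5 / 1260)%C.
  2:{ rewrite Hv. field. unfold v. intros E. apply Hw.
      replace w with (w / (1 - w) * (1 - w))%C by (field; exact H1). rewrite E. ring. }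
  unfold v. field. split; assumption.
Qed.

Lemma Cmod_monomial_le (a : R) (w : C) (k : nat) :
  Cmod w <= 1 -> Cmod (RtoC a * w ^ k)%C <= Rabs a.
Proof.
  intros Hw. rewrite Cmod_mult, Cmod_R, Cmod_pow.
  assert (Cmod w ^ k <= 1).
  { rewrite <- (pow1 k). apply pow_incr. split; [apply Cmod_ge_0|exact Hw]. }
  pose proof (Rabs_pos a). nra.
Qed.

Lemma stirling_arg_step (nu s : R) : 2 <= nu ->
  Rabs (stirling_arg nu s - stirling_arg nu (s - 1) - Im (zlog nu s)) <= 110 * Cmod (/ (s, nu)) ^ 8.
Proof.
  intros Hnu. pose proof (zlog_step nu s Hnu) as L.
  set (w := (/ (s, nu))%C) in *. cbv zeta in L.
  set (P := (w + w ^ 2 / 2 + w ^ 3 / 3 + w ^ 4 / 4 + w ^ 5 / 5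
     + w ^ 6 / 6 + w ^ 7 / 7 + w ^ 8 / 8)%C) in *.
  set (r := (zlog nu s - zlog nu (s - 1) - P)%C) in *.
  set (z := (s, nu) : C) in *.
  assert (Hz : z <> 0) by (apply C_neq_0_im; lra).
  assert (Hw : Cmod w <= / 2) by (now apply Cmod_inv_le_half).
  pose proof (Cmod_ge_0 w) as Hw0.
  pose proof (Cmod_one_sub_ge _ _ Hw) as H1.
  assert (H2 : (1 - w)%C <> 0) by (apply Cmod_neq_0; lra).
  assert (Hwz : w <> 0). { unfold w. intros E. apply C1_nz. rewrite <- (Cinv_r z Hz), E. ring. }
  assert (Ez : z = (/ w)%C). { unfold w. field. exact Hz. }
  assert (Ez1 : (((s - 1)%R, nu) : C) = (/ w - 1)%C).
  { rewrite <- Ez. apply injective_projections; simpl; ring. }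
  set (Q := (- (83) / 720 + 371 / 720 * w - 67 / 72 * w ^ 2 + 5 / 6 * w ^ 3 - 41 / 112 * w ^ 4
     + / 16 * w ^ 5)%C).
  assert (E : stirling_arg nu s - stirling_arg nu (s - 1) - Im (zlog nu s)
     = Im ((/ w - / 2) * r + w ^ 8 * Q / (1 - w) ^ 5)%C).
  { unfold stirling_arg. rewrite Ez1. fold z. rewrite Ez.
    assert (Hr : zlog nu (s - 1) = (zlog nu s - P - r)%C) by (unfold r; ring).
    rewrite Hr. generalize (zlog nu s). intros a. generalize r. intros r'.
    unfold stirling_tail.
    rewrite <- !im_minus. f_equal.
    now apply stirling_step_identity. }
  rewrite E. eapply Rle_trans; [apply im_le_Cmod|].
  eapply Rle_trans; [apply Cmod_triangle|].
  assert (HQ : Cmod Q <= 3).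
  { replace Q with (RtoC (- (83) / 720) * w ^ 0 + RtoC (371 / 720) * w ^ 1
      + RtoC (- (67) / 72) * w ^ 2 + RtoC (5 / 6) * w ^ 3
      + RtoC (- (41) / 112) * w ^ 4 + RtoC (/ 16) * w ^ 5)%C.
    2:{ unfold Q. unfold Rdiv. rewrite !RtoC_mult, !RtoC_inv, !RtoC_opp by lra. field. }
    set (q0 := (RtoC (- (83) / 720) * w ^ 0)%C). set (q1 := (RtoC (371 / 720) * w ^ 1)%C).
    set (q2 := (RtoC (- (67) / 72) * w ^ 2)%C). set (q3 := (RtoC (5 / 6) * w ^ 3)%C).
    set (q4 := (RtoC (- (41) / 112) * w ^ 4)%C). set (q5 := (RtoC (/ 16) * w ^ 5)%C).
    pose proof (Cmod_triangle (q0 + q1 + q2 + q3 + q4) q5).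
    pose proof (Cmod_triangle (q0 + q1 + q2 + q3) q4).
    pose proof (Cmod_triangle (q0 + q1 + q2) q3).
    pose proof (Cmod_triangle (q0 + q1) q2). pose proof (Cmod_triangle q0 q1).
    assert (Hw1 : Cmod w <= 1) by lra.
    pose proof (fun a k => Cmod_monomial_le a w k Hw1) as M.
    pose proof (M (- (83) / 720) 0%nat) as M0. pose proof (M (371 / 720) 1%nat) as M1.
    pose proof (M (- (67) / 72) 2%nat) as M2. pose proof (M (5 / 6) 3%nat) as M3.
    pose proof (M (- (41) / 112) 4%nat) as M4. pose proof (M (/ 16) 5%nat) as M5.
    fold q0 in M0. fold q1 in M1. fold q2 in M2. fold q3 in M3. fold q4 in M4. fold q5 in M5.
    rewrite Rabs_left in M0, M2, M4 by lra. rewrite Rabs_pos_eq in M1, M3, M5 by lra.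
    lra. }
  assert (P8 : 0 <= Cmod w ^ 8) by (apply pow_le; exact Hw0).
  assert (T1 : Cmod ((/ w - / 2) * r)%C <= 6 * Cmod w ^ 8).
  { assert (Hwp : 0 < Cmod w) by (now apply Cmod_gt_0).
    rewrite Cmod_mult. apply Rle_trans with ((/ Cmod w + / 2) * (4 * Cmod w ^ 9)).
    - apply Rmult_le_compat; try apply Cmod_ge_0; [|exact L].
      unfold Cminus. eapply Rle_trans; [apply Cmod_triangle|].
      rewrite Cmod_opp, Cmod_inv by exact Hwz.
      rewrite <- RtoC_inv, Cmod_R, Rabs_pos_eq by lra. lra.
    - replace ((/ Cmod w + / 2) * (4 * Cmod w ^ 9)) with ((4 + 2 * Cmod w) * Cmod w ^ 8)
        by (field; lra).
      apply Rmult_le_compat_r; [exact P8|lra]. }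
  assert (T2 : Cmod (w ^ 8 * Q / (1 - w) ^ 5)%C <= 96 * Cmod w ^ 8).
  { rewrite Cmod_div by (now apply Cpow_nz). rewrite Cmod_mult, !Cmod_pow.
    assert (H5 : / 32 <= Cmod (1 - w)%C ^ 5).
    { replace (/ 32) with ((1 - / 2) ^ 5) by field. apply pow_incr. lra. }
    apply Rmult_le_reg_r with (Cmod (1 - w)%C ^ 5); [lra|].
    unfold Rdiv. rewrite Rmult_assoc, Rinv_l, Rmult_1_r by lra.
    apply Rle_trans with (3 * Cmod w ^ 8); [rewrite Rmult_comm; now apply Rmult_le_compat_r|].
    apply Rle_trans with (96 * Cmod w ^ 8 * / 32); [lra|]. apply Rmult_le_compat_l; lra. }
  lra.
Qed.

(** * The argument of Gamma on a vertical line *)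

(** [exp (i a)]. *)
Definition cis (a : R) : C := (cos a, sin a).

Lemma cis_plus (a b : R) : cis (a + b) = (cis a * cis b)%C.
Proof.
  unfold cis. rewrite cos_plus, sin_plus. apply injective_projections; simpl; ring.
Qed.

Lemma cis_0 : cis 0 = RtoC 1.
Proof. unfold cis. now rewrite cos_0, sin_0. Qed.

Lemma Cmod_cis (a : R) : Cmod (cis a) = 1.
Proof.
  pose proof (sin2_cos2 a) as H. unfold Rsqr in H.
  unfold Cmod, cis; cbn -[pow]. replace (cos a ^ 2 + sin a ^ 2) with 1 by lra. apply sqrt_1.
Qed.

Lemma cos_lipschitz (a b : R) : Rabs (cos a - cos b) <= Rabs (a - b).
Proof.
  rewrite <- (Rmult_1_l (Rabs (a - b))).
  apply (bounded_variation cos (fun t => - sin t)). intros t _. split.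
  - auto_derive; trivial; ring.
  - rewrite Rabs_Ropp. apply Rabs_sin_le.
Qed.

Lemma sin_lipschitz (a b : R) : Rabs (sin a - sin b) <= Rabs (a - b).
Proof.
  rewrite <- (Rmult_1_l (Rabs (a - b))).
  apply (bounded_variation sin cos). intros t _. split.
  - auto_derive; trivial; ring.
  - apply Rabs_cos_le.
Qed.

Lemma cis_lipschitz (a b : R) : Cmod (cis a - cis b)%C <= 2 * Rabs (a - b).
Proof.
  eapply Rle_trans; [apply Cmod_le_abs|].
  pose proof (cos_lipschitz a b). pose proof (sin_lipschitz a b).
  change (Rabs (cos a - cos b) + Rabs (sin a - sin b) <= 2 * Rabs (a - b)). lra.
Qed.

Lemma zlog_polar (nu s : R) : 0 < nu ->
  ((s, nu) : C) = (RtoC (sqrt (s ^ 2 + nu ^ 2)) * cis (Im (zlog nu s)))%C.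
Proof.
  intros Hnu. set (q := sqrt (s ^ 2 + nu ^ 2)).
  assert (Hp : 0 < s ^ 2 + nu ^ 2) by (pose proof (pow2_ge_0 s); nra).
  assert (Hq : 0 < q) by (now apply sqrt_lt_R0).
  assert (E : sqrt (1 + (s / nu)²) = q / nu).
  { replace (1 + (s / nu)²) with ((s ^ 2 + nu ^ 2) / nu ^ 2) by (unfold Rsqr; field; lra).
    rewrite sqrt_div by nra. rewrite (sqrt_pow2 nu) by lra. reflexivity. }
  unfold cis, zlog. cbn -[pow]. rewrite cos_shift, sin_shift, sin_atan, cos_atan, E.
  apply injective_projections; cbn -[pow]; field; lra.
Qed.

Lemma Gm_succ (n : nat) (nu : R) : Gm (S n) nu = ((INR (S n), nu) * Gm n nu)%C.
Proof.
  unfold Gm. rewrite gammaC_succ, gammaS_succ.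
  apply injective_projections; cbn -[INR]; ring.
Qed.

Lemma Gm_asymptotics (N : nat) (nu : R) : (2 <= N)%nat -> 0 <= nu ->
  Cmod (Gm N nu / RtoC (INR (fact N)) - cis (nu * ln (INR N)))%C <= 6 * nu / sqrt (INR N).
Proof.
  intros HN Hnu.
  assert (HI : 0 < INR N) by (apply lt_0_INR; lia).
  assert (Hlip : forall t, 0 < t ->
     Rabs (nu * ln t - nu * ln (INR N)) = nu * Rabs (ln (t / INR N))).
  { intros t Ht. rewrite <- Rmult_minus_distr_l, <- ln_div by trivial.
    rewrite Rabs_mult, (Rabs_pos_eq nu); trivial. }
  assert (H1 : Rabs (gammaC N nu / INR (fact N) - cos (nu * ln (INR N))) <= 3 * nu / sqrt (INR N)).
  { apply gamma_weight_concentration with (fun t => cos (nu * ln t)); trivial.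
    - intros t Ht. rewrite <- Hlip by trivial. apply cos_lipschitz.
    - apply gammaC_correct. }
  assert (H2 : Rabs (gammaS N nu / INR (fact N) - sin (nu * ln (INR N))) <= 3 * nu / sqrt (INR N)).
  { apply gamma_weight_concentration with (fun t => sin (nu * ln t)); trivial.
    - intros t Ht. rewrite <- Hlip by trivial. apply sin_lipschitz.
    - apply gammaS_correct. }
  pose proof (INR_fact_neq_0 N) as HF.
  eapply Rle_trans; [apply Cmod_le_abs|].
  replace (Re (Gm N nu / RtoC (INR (fact N)) - cis (nu * ln (INR N)))%C)
    with (gammaC N nu / INR (fact N) - cos (nu * ln (INR N))) by (cbn -[INR fact]; field; exact HF).
  replace (Im (Gm N nu / RtoC (INR (fact N)) - cis (nu * ln (INR N)))%C)
    with (gammaS N nu / INR (fact N) - sin (nu * ln (INR N))) by (cbn -[INR fact]; field; exact HF).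
  unfold Rdiv in *. lra.
Qed.

Definition stirling_defect (nu : R) (k : nat) : R :=
  stirling_arg nu (INR (S k)) - stirling_arg nu (INR k) - Im (zlog nu (INR (S k))).

Lemma Gm_polar (nu : R) (n : nat) : 0 < nu ->
  exists q, 0 < q /\ Gm (S n) nu
    = (RtoC q * cis (stirling_arg nu (INR (S n)) - stirling_arg nu 0 - sum_n (stirling_defect nu) n) * Gm 0 nu)%C.
Proof.
  intros Hnu.
  assert (Hs : forall s, 0 < sqrt (s ^ 2 + nu ^ 2)).
  { intros s. apply sqrt_lt_R0. pose proof (pow2_ge_0 s). nra. }
  induction n as [|n [q [Hq IH]]].
  - exists (sqrt (INR 1 ^ 2 + nu ^ 2)). split; [apply Hs|].
    rewrite Gm_succ, sum_O. rewrite (zlog_polar nu (INR 1)) by trivial.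
    do 2 f_equal. f_equal. unfold stirling_defect. simpl INR. ring.
  - exists (sqrt (INR (S (S n)) ^ 2 + nu ^ 2) * q). split.
    + apply Rmult_lt_0_compat; [apply Hs|exact Hq].
    + rewrite Gm_succ, IH, sum_Sn. change plus with Rplus.
      rewrite (zlog_polar nu (INR (S (S n)))) at 1 by trivial.
      replace (stirling_arg nu (INR (S (S n))) - stirling_arg nu 0 - (sum_n (stirling_defect nu) n + stirling_defect nu (S n)))
        with (Im (zlog nu (INR (S (S n)))) + (stirling_arg nu (INR (S n)) - stirling_arg nu 0 - sum_n (stirling_defect nu) n))
        by (unfold stirling_defect; ring).
      rewrite cis_plus, RtoC_mult. ring.
Qed.

(** A bound by a telescoping difference, which makes the sum over [k] explicit:
    [1 / (a+1)^8 <= 1/a^7 - 1/(a+1)^7], and [s^2 + nu^2 >= (s + nu)^2 / 2]. *)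
Lemma stirling_defect_le (nu : R) (k : nat) : 2 <= nu ->
  Rabs (stirling_defect nu k) <= 1760 * (/ (INR k + nu) ^ 7 - / (INR (S k) + nu) ^ 7).
Proof.
  intros Hnu. unfold stirling_defect.
  pose proof (stirling_arg_step nu (INR (S k)) Hnu) as H.
  replace (INR (S k) - 1) with (INR k) in H by (rewrite S_INR; ring).
  eapply Rle_trans; [exact H|]. clear H.
  rewrite S_INR. pose proof (pos_INR k) as Hk. set (s := INR k + 1).
  rewrite Cmod_inv by (apply C_neq_0_im; lra).
  assert (Hs : 1 <= s) by (unfold s; lra).
  replace (INR k) with (s - 1) by (unfold s; ring).
  replace ((/ Cmod (s, nu)) ^ 8) with (/ (s ^ 2 + nu ^ 2) ^ 4)
    by (rewrite <- Cmod_pair_sqr, <- pow_mult, pow_inv; reflexivity).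
  set (a := s - 1 + nu). replace (s + nu) with (a + 1) by (unfold a; ring).
  assert (Ha : 2 <= a) by (unfold a; lra).
  assert (H1 : / (s ^ 2 + nu ^ 2) ^ 4 <= 16 * / (a + 1) ^ 8).
  { replace (16 * / (a + 1) ^ 8) with (/ ((a + 1) ^ 2 / 2) ^ 4) by (field; lra).
    assert (0 < (a + 1) ^ 2 / 2) by nra.
    apply Rinv_le_contravar; [now apply pow_lt|].
    apply pow_incr. split; [lra|]. replace (a + 1) with (s + nu) by (unfold a; ring).
    pose proof (pow2_ge_0 (s - nu)). nra. }
  assert (H2 : / (a + 1) ^ 8 <= / a ^ 7 - / (a + 1) ^ 7).
  { apply Rmult_le_reg_r with (a ^ 7 * (a + 1) ^ 8).
    { apply Rmult_lt_0_compat; apply pow_lt; lra. }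
    replace (/ (a + 1) ^ 8 * (a ^ 7 * (a + 1) ^ 8)) with (a ^ 6 * a) by (field; lra).
    replace ((/ a ^ 7 - / (a + 1) ^ 7) * (a ^ 7 * (a + 1) ^ 8))
      with ((a + 1) ^ 6 * (a + 1) ^ 2 - a ^ 6 * (a * (a + 1))) by (field; lra).
    assert (a ^ 6 <= (a + 1) ^ 6) by (apply pow_incr; lra).
    assert (0 <= a ^ 6) by (apply pow_le; lra).
    assert (H3 : a ^ 6 * (a + 1) ^ 2 <= (a + 1) ^ 6 * (a + 1) ^ 2)
      by (apply Rmult_le_compat_r; [apply pow2_ge_0|assumption]).
    replace (a ^ 6 * (a + 1) ^ 2) with (a ^ 6 * (a * (a + 1)) + a ^ 6 * a + a ^ 6) in H3 by ring.
    lra. }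
  lra.
Qed.

Lemma stirling_defect_series (nu : R) : 2 <= nu ->
  ex_series (stirling_defect nu) /\ Rabs (Series (stirling_defect nu)) <= 1760 / nu ^ 7.
Proof.
  intros Hnu. set (d := fun k => 1760 * (/ (INR k + nu) ^ 7 - / (INR (S k) + nu) ^ 7)).
  assert (Hd : is_series d (1760 / nu ^ 7)).
  { change (is_lim_seq (sum_n d) (Finite (1760 / nu ^ 7))).
    apply is_lim_seq_ext with (fun n => 1760 / nu ^ 7 - 1760 * / (INR (S n) + nu) ^ 7).
    { intros n. induction n as [|n IH].
      - rewrite sum_O. unfold d. simpl INR. rewrite Rplus_0_l. unfold Rdiv. ring.
      - rewrite sum_Sn, <- IH. unfold d. change plus with Rplus. ring. }
    replace (Finite (1760 / nu ^ 7)) with (Finite (1760 / nu ^ 7 - 0)) by (f_equal; ring).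
    apply is_lim_seq_minus'; [apply is_lim_seq_const|].
    apply is_lim_seq_le_le with (fun _ => 0) (fun n => 1760 * / INR (S n)).
    - intros n. pose proof (pos_INR n) as Hn. rewrite S_INR.
      assert (H1 : 1 <= INR n + 1 + nu) by lra.
      assert (H2 : INR n + 1 <= (INR n + 1 + nu) ^ 7).
      { apply Rle_trans with ((INR n + 1 + nu) ^ 1); [simpl; lra|].
        apply Rle_pow; [lra|lia]. }
      split.
      + apply Rmult_le_pos; [lra|]. left. apply Rinv_0_lt_compat. lra.
      + apply Rmult_le_compat_l; [lra|]. apply Rinv_le_contravar; lra.
    - apply is_lim_seq_const.
    - replace (Finite 0) with (Rbar_mult 1760 0) by (simpl; f_equal; ring).
      apply is_lim_seq_scal_l.
      apply (is_lim_seq_incr_1 (fun n => / INR n)).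
      apply (is_lim_seq_inv _ p_infty); [apply is_lim_seq_INR|discriminate]. }
  assert (Ha : ex_series (fun k => Rabs (stirling_defect nu k))).
  { apply (ex_series_le (K := R_AbsRing) (V := R_CompleteNormedModule)) with d.
    - intros n. change (Rabs (Rabs (stirling_defect nu n)) <= d n). rewrite Rabs_Rabsolu.
      now apply stirling_defect_le.
    - now exists (1760 / nu ^ 7). }
  split; [now apply ex_series_Rabs|].
  eapply Rle_trans; [now apply Series_Rabs|].
  rewrite <- (is_series_unique _ _ Hd). apply Series_le.
  - intros n. split; [apply Rabs_pos|now apply stirling_defect_le].
  - now exists (1760 / nu ^ 7).
Qed.

Lemma atan_bounds (u : R) : 0 <= u -> u / (1 + u ^ 2) <= atan u <= u.
Proof.
  intros Hu.
  destruct (MVT_gen atan 0 u (fun t => / (1 + t²))) as [c [Hc E]].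
  - intros; apply is_derive_atan.
  - intros; apply continuity_pt_filterlim, (ex_derive_continuous atan).
    eexists; apply is_derive_atan.
  - rewrite Rmin_left, Rmax_right in Hc by lra. rewrite atan_0, !Rminus_0_r in E. rewrite E.
    unfold Rsqr. unfold Rdiv. rewrite (Rmult_comm u).
    assert (0 <= c * c <= u ^ 2) by nra.
    split; [apply Rmult_le_compat_r; [lra|apply Rinv_le_contravar; lra]|].
    rewrite <- (Rmult_1_l u) at 2. apply Rmult_le_compat_r; [lra|].
    rewrite <- Rinv_1. apply Rinv_le_contravar; lra.
Qed.

Lemma stirling_arg_expand (nu s : R) :
  stirling_arg nu s = (s + / 2) * (PI / 2 - atan (s / nu)) + nu * (ln (s ^ 2 + nu ^ 2) / 2) - nu
    + Im (stirling_tail (s, nu)).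
Proof.
  unfold stirling_arg. rewrite <- RtoC_inv by lra. generalize (stirling_tail (s, nu)). intros c.
  unfold zlog, Im. cbn -[pow ln atan]. ring.
Qed.

Lemma stirling_tail_le (z : C) : 1 <= Cmod z -> Cmod (stirling_tail z) <= / Cmod z.
Proof.
  intros Hz. assert (Hz0 : z <> 0) by (apply Cmod_neq_0; lra).
  assert (Hw : Cmod (/ z) <= 1).
  { rewrite Cmod_inv by exact Hz0. rewrite <- Rinv_1. apply Rinv_le_contravar; lra. }
  rewrite <- Cmod_inv by exact Hz0. set (w := (/ z)%C) in *.
  replace (stirling_tail z) with
    (w * (RtoC (/ 12) * w ^ 0 + RtoC (- / 360) * w ^ 2 + RtoC (/ 1260) * w ^ 4))%C.
  2:{ unfold stirling_tail, w. rewrite RtoC_opp, !RtoC_inv by lra. field. exact Hz0. }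
  rewrite Cmod_mult. rewrite <- (Rmult_1_r (Cmod w)) at 2.
  apply Rmult_le_compat_l; [apply Cmod_ge_0|].
  set (q0 := (RtoC (/ 12) * w ^ 0)%C). set (q1 := (RtoC (- / 360) * w ^ 2)%C).
  set (q2 := (RtoC (/ 1260) * w ^ 4)%C).
  pose proof (Cmod_triangle (q0 + q1) q2). pose proof (Cmod_triangle q0 q1).
  pose proof (Cmod_monomial_le (/ 12) w 0 Hw) as M0.
  pose proof (Cmod_monomial_le (- / 360) w 2 Hw) as M1.
  pose proof (Cmod_monomial_le (/ 1260) w 4 Hw) as M2.
  fold q0 in M0. fold q1 in M1. fold q2 in M2.
  rewrite Rabs_pos_eq in M0, M2 by lra. rewrite Rabs_left in M1 by lra. lra.
Qed.

(** As [s] grows, Stirling's argument of [Gamma (1 + s + i nu)] approaches that of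
    [s^{i nu}], the value found in [Gm_asymptotics]. *)
Lemma stirling_arg_asymptotics (nu s : R) : 1 <= nu -> 1 <= s ->
  Rabs (stirling_arg nu s - nu * ln s) <= (nu + 2 * nu ^ 3 + 1) / s.
Proof.
  intros Hnu Hs. rewrite stirling_arg_expand.
  rewrite <- atan_inv by (apply Rdiv_lt_0_compat; lra).
  replace (/ (s / nu)) with (nu / s) by (field; lra).
  set (h := / s). assert (Hh : 0 < h <= 1).
  { unfold h. split; [apply Rinv_0_lt_compat; lra|].
    rewrite <- Rinv_1. apply Rinv_le_contravar; lra. }
  assert (Hsh : s * h = 1) by (unfold h; field; lra).
  unfold Rdiv. fold h. set (u := nu * h).
  assert (Hu : 0 <= u) by (unfold u; apply Rmult_le_pos; lra).
  pose proof (atan_bounds u Hu) as [A1 A2].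
  assert (A3 : u - u ^ 3 <= atan u).
  { eapply Rle_trans; [|exact A1]. apply Rmult_le_reg_r with (1 + u ^ 2); [nra|].
    unfold Rdiv. rewrite Rmult_assoc, Rinv_l by nra.
    assert (0 <= u ^ 5) by (now apply pow_le). nra. }
  assert (L : 0 <= ln (s ^ 2 + nu ^ 2) - 2 * ln s <= u ^ 2).
  { replace (2 * ln s) with (ln (s ^ 2)) by (rewrite ln_pow by lra; simpl; ring).
    rewrite <- ln_div by nra.
    replace ((s ^ 2 + nu ^ 2) / s ^ 2) with (1 + u ^ 2) by (unfold u, h; field; lra).
    split.
    - rewrite <- ln_1. apply ln_le; nra.
    - pose proof (exp_ineq1_le (u ^ 2)). rewrite <- (ln_exp (u ^ 2)) at 2.
      apply ln_le; nra. }
  assert (T : Rabs (Im (stirling_tail (s, nu))) <= h).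
  { assert (Hz : s <= Cmod (s, nu)).
    { pose proof (re_le_Cmod (s, nu)) as H. simpl in H. rewrite Rabs_pos_eq in H; lra. }
    eapply Rle_trans; [apply im_le_Cmod|].
    eapply Rle_trans; [apply stirling_tail_le; lra|]. apply Rinv_le_contravar; lra. }
  apply Rabs_le_between in T. apply Rabs_le.
  assert (U3 : u ^ 3 * s <= nu ^ 3 * h).
  { replace (u ^ 3 * s) with (nu ^ 3 * h * h * (s * h)) by (unfold u; ring). rewrite Hsh.
    assert (0 <= nu ^ 3) by (apply pow_le; lra).
    assert (0 <= nu ^ 3 * h) by (apply Rmult_le_pos; lra). nra. }
  assert (U2 : nu * u ^ 2 <= nu ^ 3 * h).
  { replace (nu * u ^ 2) with (nu ^ 3 * h * h) by (unfold u; ring).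
    assert (0 <= nu ^ 3) by (apply pow_le; lra).
    assert (0 <= nu ^ 3 * h) by (apply Rmult_le_pos; lra). nra. }
  assert (Us : u * s = nu) by (unfold u; rewrite Rmult_assoc, (Rmult_comm h), Hsh; ring).
  assert (B1 : (s + / 2) * atan u <= (s + / 2) * u) by (apply Rmult_le_compat_l; lra).
  assert (B0 : 0 <= atan u).
  { eapply Rle_trans; [|exact A1]. apply Rdiv_le_0_compat; nra. }
  assert (B2 : s * (u - u ^ 3) <= s * atan u) by (apply Rmult_le_compat_l; lra).
  assert (B3 : nu * (ln (s ^ 2 + nu ^ 2) - 2 * ln s) <= nu * u ^ 2)
    by (apply Rmult_le_compat_l; lra).
  assert (B4 : 0 <= nu * (ln (s ^ 2 + nu ^ 2) - 2 * ln s)) by (apply Rmult_le_pos; lra).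
  assert (B5 : u = nu * h) by reflexivity.
  assert (B6 : 0 <= nu ^ 3 * h) by (apply Rmult_le_pos; [apply pow_le|]; lra).
  split; nra.
Qed.

(** The arguments of the [Gm] are compared through this criterion: the moduli enter
    only as unspecified positive factors [q]. *)
Lemma positive_real_of_scaled_limit (T : C) :
  (forall eps, 0 < eps -> exists q, 0 < q /\ Cmod (RtoC q * T - 1)%C <= eps) ->
  0 < Re T /\ Im T = 0.
Proof.
  intros H.
  assert (C : forall eps, 0 < eps -> exists q, 0 < q /\ Rabs (q * Re T - 1) <= eps
     /\ Rabs (q * Im T) <= eps).
  { intros eps He. destruct (H eps He) as [q [Hq Hc]]. exists q. split; [exact Hq|].
    pose proof (re_le_Cmod (RtoC q * T - 1)%C) as R1.
    pose proof (im_le_Cmod (RtoC q * T - 1)%C) as R2.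
    replace (Re (RtoC q * T - 1)%C) with (q * Re T - 1) in R1 by (unfold Re; simpl; ring).
    replace (Im (RtoC q * T - 1)%C) with (q * Im T) in R2 by (unfold Im; simpl; ring).
    lra. }
  assert (P : 0 < Re T).
  { destruct (C (/ 2)) as [q [Hq [H1 _]]]; [lra|]. apply Rabs_le_between in H1. nra. }
  split; [exact P|].
  destruct (Req_dec (Im T) 0) as [E|E]; [exact E|exfalso].
  assert (HI : 0 < Rabs (Im T)) by (now apply Rabs_pos_lt).
  set (e := Rabs (Im T) / (4 * Re T)).
  assert (He : 0 < e) by (apply Rdiv_lt_0_compat; lra).
  destruct (C (Rmin (/ 2) e)) as [q [Hq [H1 H2]]]; [apply Rmin_pos; lra|].
  pose proof (Rmin_l (/ 2) e). pose proof (Rmin_r (/ 2) e).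
  apply Rabs_le_between in H1. rewrite Rabs_mult, (Rabs_pos_eq q) in H2 by lra.
  assert (K3 : / 2 <= q * Re T) by lra.
  assert (K4 : q * Rabs (Im T) <= e) by lra.
  assert (K5 : q * Rabs (Im T) * Re T <= Rabs (Im T) / 4).
  { replace (Rabs (Im T) / 4) with (e * Re T) by (unfold e; field; lra).
    apply Rmult_le_compat_r; lra. }
  nra.
Qed.

(** The total error of the steps of Stirling's series is the convergent sum [e].
    Rotating [Gamma (1 + i nu)] back by [stirling_arg nu 0 + e] gives a number of
    which some positive multiples come arbitrarily close to [1], by comparing [Gm_polar] with
    [Gm_asymptotics] for large [N]. *)
Lemma gamma_angle (nu : R) : 2 <= nu ->
  exists q e, 0 < q /\ Rabs e <= 1760 / nu ^ 7 /\ Gm 0 nu = (RtoC q * cis (stirling_arg nu 0 + e))%C.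
Proof.
  intros Hnu. destruct (stirling_defect_series nu Hnu) as [Hex He].
  set (e := Series (stirling_defect nu)) in *.
  set (T := (Gm 0 nu * cis (- (stirling_arg nu 0 + e)))%C).
  assert (HT : 0 < Re T /\ Im T = 0).
  { apply positive_real_of_scaled_limit. intros eps Heps.
    assert (L1 : is_lim_seq (fun n => 6 * nu * / sqrt (INR (S n))) 0).
    { replace (Finite 0) with (Rbar_mult (6 * nu) 0) by (simpl; f_equal; ring).
      apply is_lim_seq_scal_l.
      apply (is_lim_seq_incr_1 (fun n => / sqrt (INR n))).
      apply (is_lim_seq_inv _ p_infty); [|discriminate].
      apply (filterlim_comp _ _ _ INR sqrt _ (Rbar_locally p_infty)).
      - apply is_lim_seq_INR.
      - apply filterlim_sqrt_p. }
    assert (L2 : is_lim_seq (fun n => (nu + 2 * nu ^ 3 + 1) * / INR (S n)) 0).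
    { replace (Finite 0) with (Rbar_mult (nu + 2 * nu ^ 3 + 1) 0) by (simpl; f_equal; ring).
      apply is_lim_seq_scal_l.
      apply (is_lim_seq_incr_1 (fun n => / INR n)).
      apply (is_lim_seq_inv _ p_infty); [apply is_lim_seq_INR|discriminate]. }
    assert (L3 : is_lim_seq (sum_n (stirling_defect nu)) e).
    { apply (Series_correct _ Hex). }
    apply is_lim_seq_spec in L1. apply is_lim_seq_spec in L2. apply is_lim_seq_spec in L3.
    assert (e8 : 0 < eps / 8) by lra.
    destruct (L1 (mkposreal _ e8)) as [N1 M1]. destruct (L2 (mkposreal _ e8)) as [N2 M2].
    destruct (L3 (mkposreal _ e8)) as [N3 M3]. cbn -[INR pow sum_n] in M1, M2, M3.
    set (n := (S (N1 + N2 + N3))%nat).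
    specialize (M1 n ltac:(unfold n; lia)). specialize (M2 n ltac:(unfold n; lia)).
    specialize (M3 n ltac:(unfold n; lia)).
    destruct (Gm_polar nu n ltac:(lra)) as [r [Hr E]].
    pose proof (Gm_asymptotics (S n) nu ltac:(unfold n; lia) ltac:(lra)) as A.
    assert (HSn : 1 <= INR (S n)). { rewrite S_INR. pose proof (pos_INR n). lra. }
    pose proof (stirling_arg_asymptotics nu (INR (S n)) ltac:(lra) HSn) as B.
    set (F := INR (fact (S n))) in *.
    assert (HF : 0 < F) by apply INR_fact_lt_0.
    exists (r / F). split; [now apply Rdiv_lt_0_compat|].
    set (s := sum_n (stirling_defect nu) n) in *. set (p := stirling_arg nu (INR (S n))) in *.
    (* cis d is the direction of Gm (S n) nu if T is positive, up to the tail
       e - s of the error series; d - nu ln (S n) tends to 0 *)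
    set (d := p + e - s).
    assert (E2 : (RtoC (r / F) * T - 1)%C = ((Gm (S n) nu / RtoC F - cis d) * cis (- d))%C).
    { assert (Hcc : (cis d * cis (- d))%C = 1).
      { rewrite <- cis_plus, Rplus_opp_r. apply cis_0. }
      replace ((Gm (S n) nu / RtoC F - cis d) * cis (- d))%C
        with (Gm (S n) nu / RtoC F * cis (- d) - cis d * cis (- d))%C by ring.
      rewrite Hcc, E. unfold T.
      replace (- (stirling_arg nu 0 + e)) with ((p - stirling_arg nu 0 - s) + - d) by (unfold d; ring).
      rewrite cis_plus. unfold Rdiv. rewrite RtoC_mult, RtoC_inv by lra. unfold Cdiv. ring. }
    rewrite E2, Cmod_mult, Cmod_cis, Rmult_1_r.
    set (v := nu * ln (INR (S n))) in *.
    replace (Gm (S n) nu / RtoC F - cis d)%C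
      with ((Gm (S n) nu / RtoC F - cis v) + (cis v - cis d))%C by ring.
    eapply Rle_trans; [apply Cmod_triangle|].
    pose proof (cis_lipschitz v d) as D.
    assert (D2 : Rabs (v - d) <= Rabs (p - v) + Rabs (s - e)).
    { replace (v - d) with (- (p - v) + (s - e)) by (unfold d; ring).
      eapply Rle_trans; [apply Rabs_triang|]. rewrite Rabs_Ropp. lra. }
    rewrite Rminus_0_r in M1, M2. apply Rabs_def2 in M1, M2.
    unfold Rdiv in A, B. lra. }
  destruct HT as [HT1 HT2].
  exists (Re T), e. split; [exact HT1|]. split; [exact He|].
  replace (RtoC (Re T)) with T.
  - unfold T. rewrite <- Cmult_assoc, <- cis_plus, Rplus_opp_l, cis_0. ring.
  - destruct T as [a b]. simpl in HT2. subst b. reflexivity.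
Qed.

Lemma stirling_arg_zero (nu : R) : 0 < nu ->
  stirling_arg nu 0 = nu * ln nu - nu + PI / 4 - (/ (12 * nu) + / (360 * nu ^ 3) + / (1260 * nu ^ 5)).
Proof.
  intros Hnu. rewrite stirling_arg_expand.
  replace (Im (stirling_tail (0, nu)))
    with (- (/ (12 * nu) + / (360 * nu ^ 3) + / (1260 * nu ^ 5))).
  - replace (0 ^ 2 + nu ^ 2) with (nu ^ 2) by ring. rewrite ln_pow by exact Hnu.
    replace (0 / nu) with 0 by (field; lra). rewrite atan_0. simpl INR. field. lra.
  - unfold stirling_tail.
    replace ((0, nu) : C) with (Ci * RtoC nu)%C by (apply injective_projections; simpl; ring).
    assert (Hn : RtoC nu <> 0) by (intros E; injection E; lra).
    assert (HCi : Ci <> 0) by (intros E; injection E; lra).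
    assert (I2 : (Ci * Ci)%C = (- (1))%C) by (apply injective_projections; simpl; ring).
    replace (/ (12 * (Ci * nu)) - / (360 * (Ci * nu) ^ 3) + / (1260 * (Ci * nu) ^ 5))%C
      with (- Ci * RtoC (/ (12 * nu) + / (360 * nu ^ 3) + / (1260 * nu ^ 5)))%C.
    + unfold Im. simpl. ring.
    + assert (P3 : (Ci ^ 3 = - Ci)%C).
      { replace (Ci ^ 3)%C with (Ci * Ci * Ci)%C by ring. rewrite I2. ring. }
      assert (P5 : (Ci ^ 5 = Ci)%C).
      { replace (Ci ^ 5)%C with ((Ci * Ci) * (Ci * Ci) * Ci)%C by ring. rewrite I2. ring. }
      rewrite !Cpow_mult_l, P3, P5.
      rewrite !RtoC_plus, !RtoC_inv, !RtoC_mult, !RtoC_pow.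
      * replace (/ (12 * (Ci * nu)))%C with (/ Ci * / (12 * nu))%C by (field; split; assumption).
        replace (/ (360 * (- Ci * nu ^ 3)))%C with (- / Ci * / (360 * nu ^ 3))%C
          by (field; split; assumption).
        replace (/ (1260 * (Ci * nu ^ 5)))%C with (/ Ci * / (1260 * nu ^ 5))%C
          by (field; split; assumption).
        rewrite Ci_inv. ring.
      * apply Rmult_integral_contrapositive_currified; [lra|apply pow_nonzero; lra].
      * apply Rmult_integral_contrapositive_currified; [lra|apply pow_nonzero; lra].
      * lra.
Qed.

(** * Polynomials *)

(** Polynomials with real coefficients, constant term first.  Lists that compute
    make it possible to check by evaluation that low-order coefficients vanish. *)
Fixpoint peval (p : list R) (w : C) : C :=
  match p with
  | nil => 0
  | a :: p => (RtoC a + w * peval p w)%C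
  end.

Fixpoint padd (p q : list R) : list R :=
  match p, q with
  | nil, _ => q
  | _, nil => p
  | a :: p, b :: q => a + b :: padd p q
  end.

Definition pscale (a : R) (p : list R) : list R := map (Rmult a) p.

Fixpoint pmul (p q : list R) : list R :=
  match p with
  | nil => nil
  | a :: p => padd (pscale a q) (0 :: pmul p q)
  end.

Lemma peval_add (p q : list R) (w : C) : peval (padd p q) w = (peval p w + peval q w)%C.
Proof.
  revert q. induction p as [|a p IH]; intros [|b q]; simpl; try ring.
  rewrite IH, RtoC_plus. ring.
Qed.

Lemma peval_scale (a : R) (p : list R) (w : C) : peval (pscale a p) w = (RtoC a * peval p w)%C.
Proof.
  induction p as [|b p IH]; simpl; [ring|].
  fold (pscale a p). rewrite IH, RtoC_mult. ring.
Qed.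

Lemma peval_mul (p q : list R) (w : C) : peval (pmul p q) w = (peval p w * peval q w)%C.
Proof.
  induction p as [|a p IH]; cbn [peval pmul]; [ring|].
  rewrite peval_add, peval_scale. cbn [peval]. rewrite IH. ring.
Qed.

Lemma peval_bounded (p : list R) :
  exists M, 0 <= M /\ forall w, Cmod w <= 1 -> Cmod (peval p w) <= M.
Proof.
  induction p as [|a p [M [HM IH]]].
  - exists 0. split; [lra|]. intros. simpl. rewrite Cmod_0. lra.
  - exists (Rabs a + M). split; [pose proof (Rabs_pos a); lra|].
    intros w Hw. simpl. eapply Rle_trans; [apply Cmod_triangle|].
    rewrite Cmod_R, Cmod_mult. pose proof (IH w Hw). pose proof (Cmod_ge_0 w).
    pose proof (Cmod_ge_0 (peval p w)). nra.
Qed.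

(** Turns the vanishing of finitely many coefficients, which is checked by
    computation, into a bound [O (w^n)]. *)
Lemma peval_low_order (n : nat) (p : list R) :
  (forall i, (i < n)%nat -> nth i p 0 = 0) ->
  exists M, 0 <= M /\ forall w, Cmod w <= 1 -> Cmod (peval p w) <= M * Cmod w ^ n.
Proof.
  revert p. induction n as [|n IH]; intros p H.
  - destruct (peval_bounded p) as [M [HM B]]. exists M. split; [exact HM|].
    intros w Hw. simpl. rewrite Rmult_1_r. auto.
  - destruct p as [|a p].
    + exists 0. split; [lra|]. intros. simpl peval. rewrite Cmod_0. lra.
    + destruct (IH p) as [M [HM B]].
      { intros i Hi. apply (H (S i)). lia. }
      exists M. split; [exact HM|]. intros w Hw.
      pose proof (H 0%nat ltac:(lia)) as H0. simpl in H0. subst a.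
      simpl. rewrite Cplus_0_l, Cmod_mult.
      pose proof (B w Hw). pose proof (Cmod_ge_0 w). nra.
Qed.

(** * Taylor polynomials of the exponential on the imaginary axis *)

(** One integration in a chain of Taylor estimates: from order [n] for the derivative
    to order [n + 1] for the function. *)
Lemma taylor_integrate (f df : R -> R) (K : R) (n : nat) (x : R) :
  f 0 = 0 -> 0 <= K ->
  (forall t, Rabs t <= Rabs x -> is_derive f t (df t) /\ Rabs (df t) <= K * Rabs t ^ n) ->
  Rabs (f x) <= K * Rabs x ^ S n.
Proof.
  intros H0 HK H.
  replace (f x) with (f x - f 0) by (rewrite H0; ring).
  replace (K * Rabs x ^ S n) with ((K * Rabs x ^ n) * Rabs (x - 0)) by (rewrite Rminus_0_r; simpl; ring).
  apply bounded_variation with df. intros t Ht. rewrite !Rminus_0_r in Ht.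
  destruct (H t Ht) as [D B].
  split; [exact D|]. eapply Rle_trans; [exact B|].
  apply Rmult_le_compat_l; [exact HK|]. apply pow_incr. split; [apply Rabs_pos|exact Ht].
Qed.

Ltac taylor_step f df :=
  intros t; apply (taylor_integrate f df);
  [ rewrite ?sin_0, ?cos_0; field | lra
  | intros u _; split; [auto_derive; trivial; field | auto] ].

Lemma Rabs_sub_sin_le (x : R) : Rabs (x - sin x) <= Rabs x ^ 3.
Proof.
  assert (C0 : forall t, Rabs (cos t) <= 1 * Rabs t ^ 0).
  { intros t. simpl. pose proof (Rabs_cos_le t). lra. }
  assert (S1 : forall t, Rabs (sin t) <= 1 * Rabs t ^ 1) by taylor_step sin cos.
  assert (C2 : forall t, Rabs (1 - cos t) <= 1 * Rabs t ^ 2) by taylor_step (fun t => 1 - cos t) sin.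
  assert (S3 : forall t, Rabs (t - sin t) <= 1 * Rabs t ^ 3)
    by taylor_step (fun t => t - sin t) (fun t => 1 - cos t).
  specialize (S3 x). lra.
Qed.

Definition exp_poly : list R := [1; 1; / 2; / 6; / 24; / 120; / 720].

Lemma cis_taylor (g : R) :
  Cmod (cis g - peval exp_poly (Ci * RtoC g))%C <= Rabs g ^ 7 + Rabs g ^ 8.
Proof.
  assert (S3 : forall t, Rabs (t - sin t) <= 1 * Rabs t ^ 3).
  { intros t. rewrite Rmult_1_l. apply Rabs_sub_sin_le. }
  assert (C4 : forall t, Rabs (t ^ 2 / 2 - (1 - cos t)) <= 1 * Rabs t ^ 4)
    by taylor_step (fun t => t ^ 2 / 2 - (1 - cos t)) (fun t => t - sin t).
  assert (S5 : forall t, Rabs (t ^ 3 / 6 - (t - sin t)) <= 1 * Rabs t ^ 5)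
    by taylor_step (fun t => t ^ 3 / 6 - (t - sin t)) (fun t => t ^ 2 / 2 - (1 - cos t)).
  assert (C6 : forall t, Rabs (t ^ 4 / 24 - (t ^ 2 / 2 - (1 - cos t))) <= 1 * Rabs t ^ 6)
    by taylor_step (fun t => t ^ 4 / 24 - (t ^ 2 / 2 - (1 - cos t)))
      (fun t => t ^ 3 / 6 - (t - sin t)).
  assert (S7 : forall t, Rabs (t ^ 5 / 120 - (t ^ 3 / 6 - (t - sin t))) <= 1 * Rabs t ^ 7)
    by taylor_step (fun t => t ^ 5 / 120 - (t ^ 3 / 6 - (t - sin t)))
      (fun t => t ^ 4 / 24 - (t ^ 2 / 2 - (1 - cos t))).
  assert (C8 : forall t, Rabs (t ^ 6 / 720 - (t ^ 4 / 24 - (t ^ 2 / 2 - (1 - cos t)))) <= 1 * Rabs t ^ 8)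
    by taylor_step (fun t => t ^ 6 / 720 - (t ^ 4 / 24 - (t ^ 2 / 2 - (1 - cos t))))
      (fun t => t ^ 5 / 120 - (t ^ 3 / 6 - (t - sin t))).
  assert (E : (cis g - peval exp_poly (Ci * RtoC g))%C =
    ((g ^ 6 / 720 - (g ^ 4 / 24 - (g ^ 2 / 2 - (1 - cos g))))%R,
     - (g ^ 5 / 120 - (g ^ 3 / 6 - (g - sin g)))%R)).
  { apply injective_projections; simpl; field. }
  rewrite E. eapply Rle_trans; [apply Cmod_le_abs|].
  unfold Re, Im. cbn [fst snd]. rewrite Rabs_Ropp.
  specialize (S7 g). specialize (C8 g). lra.
Qed.

(** * The series factor of the Bessel function *)

(** The rising factorial [(1 + i nu)_k]. *)
Fixpoint rising (nu : R) (k : nat) : C :=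
  match k with
  | 0 => 1
  | S k => ((INR (S k), nu) * rising nu k)%C
  end.

Lemma Gm_rising (nu : R) (k : nat) : Gm k nu = (rising nu k * Gm 0 nu)%C.
Proof.
  induction k as [|k IH]; [cbn; ring|]. rewrite Gm_succ, IH. cbn [rising]. ring.
Qed.

Lemma Cmod_rising_ge (nu : R) (k : nat) : 0 <= nu -> nu ^ k <= Cmod (rising nu k).
Proof.
  intros Hnu. induction k as [|k IH].
  - simpl. rewrite Cmod_1. lra.
  - cbn [rising pow]. rewrite Cmod_mult.
    apply Rmult_le_compat; [exact Hnu|now apply pow_le| |exact IH].
    pose proof (im_le_Cmod (INR (S k), nu)) as H. unfold Im in H. cbn [snd] in H.
    rewrite Rabs_pos_eq in H; lra.
Qed.

Definition series_term (c nu : R) (k : nat) : C :=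
  (RtoC (c ^ k / INR (fact k)) / rising nu k)%C.

Lemma series_term_le (c nu : R) (n k : nat) : 0 <= c -> 1 <= nu -> (n <= k)%nat ->
  Cmod (series_term c nu k) <= c ^ k / INR (fact k) * / nu ^ n.
Proof.
  intros Hc Hnu Hk. pose proof (INR_fact_lt_0 k) as HF.
  pose proof (Cmod_rising_ge nu k ltac:(lra)) as HR.
  assert (Hn : nu ^ n <= nu ^ k) by (apply Rle_pow; [lra|exact Hk]).
  assert (H0 : 0 < nu ^ n) by (apply pow_lt; lra).
  assert (H1 : 0 <= c ^ k / INR (fact k)).
  { apply Rdiv_le_0_compat; [now apply pow_le|exact HF]. }
  unfold series_term. rewrite Cmod_div by (apply Cmod_neq_0; lra).
  rewrite Cmod_R, Rabs_pos_eq by exact H1.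
  apply Rmult_le_compat_l; [exact H1|]. apply Rinv_le_contravar; lra.
Qed.

Lemma exp_partial_sum_le (c : R) (n : nat) : 0 <= c ->
  sum_n (fun k => c ^ k / INR (fact k)) n <= exp c.
Proof. intros Hc. rewrite sum_n_Reals. now apply exp_ge_taylor. Qed.

(** The [k]-th term is at most [c^k / k! * nu^-k], so that the terms from [k = 7] on
    contribute at most [e^c nu^-7]. *)
Lemma series_tail (c nu : R) : 0 <= c -> 1 <= nu ->
  exists s, is_series (K := C_AbsRing) (V := C_NormedModule) (series_term c nu) s
    /\ Cmod (s - sum_n (series_term c nu) 6)%C <= exp c / nu ^ 7.
Proof.
  intros Hc Hnu. set (a := series_term c nu).
  assert (Hex : ex_series (K := C_AbsRing) (V := C_NormedModule) a).
  { apply (ex_series_le (K := C_AbsRing) (V := C_CompleteNormedModule)) with (fun k => c ^ k / INR (fact k)).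
    - intros k. change (Cmod (a k) <= c ^ k / INR (fact k)).
      pose proof (series_term_le c nu 0 k Hc Hnu ltac:(lia)) as H.
      rewrite pow_O, Rinv_1, Rmult_1_r in H. exact H.
    - exists (exp c).
      pose proof (is_exp_Reals c) as H. apply is_pseries_R in H.
      apply is_series_ext with (2 := H). intros k. apply Rmult_comm. }
  destruct Hex as [s Hs]. exists s. split; [exact Hs|].
  set (T := sum_n a 6).
  assert (B : forall n, Cmod (sum_n a (n + 6) - T)%C
      <= sum_n (fun k => c ^ k / INR (fact k)) (n + 6) * / nu ^ 7).
  { assert (P7 : 0 < / nu ^ 7) by (apply Rinv_0_lt_compat, pow_lt; lra).
    assert (Pt : forall k, 0 <= c ^ k / INR (fact k)).
    { intros k. apply Rdiv_le_0_compat; [now apply pow_le|apply INR_fact_lt_0]. }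
    induction n as [|n IH].
    - replace (sum_n a (0 + 6) - T)%C with (RtoC 0) by (symmetry; apply Cplus_opp_r).
      rewrite Cmod_0. apply Rmult_le_pos; [|lra].
      rewrite sum_n_Reals. apply cond_pos_sum. exact Pt.
    - change (S n + 6)%nat with (S (n + 6)).
      rewrite (sum_Sn a), (sum_Sn (fun k => c ^ k / INR (fact k))).
      change (@plus C_AbelianMonoid) with Cplus. change (@plus R_AbelianMonoid) with Rplus.
      match goal with |- Cmod (?u + ?v - ?w)%C <= _ =>
        replace (u + v - w)%C with ((u - w) + v)%C by ring end.
      eapply Rle_trans; [apply Cmod_triangle|]. rewrite Rmult_plus_distr_r.
      apply Rplus_le_compat; [exact IH|]. apply series_term_le; auto; lia. }
  assert (L : is_lim_seq (fun n => norm (minus (sum_n a (n + 6)) T)) (norm (minus s T))).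
  { apply (is_lim_seq_incr_n (fun n => norm (minus (sum_n a n) T)) 6).
    apply (filterlim_comp _ _ _ (fun n => minus (sum_n a n) T) norm _ (locally (minus s T))).
    - apply (filterlim_comp_2 (F := eventually) (G := locally s) (H := locally (opp T))
         (sum_n a) (fun _ => opp T) plus).
      + exact Hs.
      + apply filterlim_const.
      + apply (filterlim_plus (K := C_AbsRing) (V := C_NormedModule)).
    - apply (filterlim_norm (K := C_AbsRing) (V := C_NormedModule)). }
  refine (is_lim_seq_le _ (fun _ => exp c / nu ^ 7) _ _ _ L (is_lim_seq_const _)).
  intros n. change (Cmod (sum_n a (n + 6) - T)%C <= exp c / nu ^ 7).
  eapply Rle_trans; [apply B|]. apply Rmult_le_compat_r.
  - left. apply Rinv_0_lt_compat, pow_lt. lra.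
  - now apply exp_partial_sum_le.
Qed.

(** * Expansion of the series factor in powers of [1 / (i nu)] *)

Fixpoint rising_poly (k : nat) : list R :=
  match k with
  | 0 => [1]
  | S k => pmul [1; INR (S k)] (rising_poly k)
  end.

Definition monomial (k : nat) : list R := repeat 0 k ++ [1].

Lemma peval_monomial (k : nat) (w : C) : peval (monomial k) w = (w ^ k)%C.
Proof.
  induction k as [|k IH]; unfold monomial; simpl; [ring|].
  fold (monomial k). rewrite IH. ring.
Qed.

Lemma Ci_nu_neq_0 (nu : R) : 1 <= nu -> (Ci * RtoC nu)%C <> 0.
Proof. intros Hnu E. injection E. lra. Qed.

Lemma Cmod_recip (nu : R) : 1 <= nu -> Cmod (/ (Ci * RtoC nu)) = / nu.
Proof.
  intros Hnu. rewrite Cmod_inv by now apply Ci_nu_neq_0.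
  rewrite Cmod_mult, Cmod_Ci, Cmod_R, Rabs_pos_eq by lra. f_equal. ring.
Qed.

Lemma rising_scaled (nu : R) (k : nat) : 1 <= nu ->
  (rising nu k * (/ (Ci * RtoC nu)) ^ k)%C = peval (rising_poly k) (/ (Ci * RtoC nu)).
Proof.
  intros Hnu. set (w := (/ (Ci * RtoC nu))%C). induction k as [|k IH]; [simpl; ring|].
  cbn [rising rising_poly]. rewrite peval_mul, <- IH. cbn [peval].
  replace ((INR (S k), nu) : C) with (RtoC (INR (S k)) + Ci * RtoC nu)%C
    by (apply injective_projections; cbn -[INR]; ring).
  rewrite Cpow_S.
  replace ((INR (S k) + Ci * nu) * rising nu k * (w * w ^ k))%C
    with (((Ci * nu) * w + INR (S k) * w) * (rising nu k * w ^ k))%C by ring.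
  unfold w at 1. rewrite Cinv_r by now apply Ci_nu_neq_0. ring.
Qed.

(** [w] is imaginary, so each factor [1 + j w] has real part [1]. *)
Lemma rising_poly_ge_1 (nu : R) (k : nat) : 1 <= nu ->
  1 <= Cmod (peval (rising_poly k) (/ (Ci * RtoC nu))).
Proof.
  intros Hnu. rewrite <- rising_scaled, Cmod_mult, Cmod_pow, Cmod_recip by exact Hnu.
  pose proof (Cmod_rising_ge nu k ltac:(lra)) as H.
  assert (P : 0 < nu ^ k) by (apply pow_lt; lra).
  rewrite pow_inv. apply Rmult_le_reg_r with (nu ^ k); [exact P|].
  rewrite Rmult_assoc, Rinv_l by lra. lra.
Qed.

(** [1 / (1 + i nu)_k = w^k / ((1 + w) ... (1 + k w))].  To expand this quotient it is
    enough to check that [P] times the denominator agrees with [w^k] to order [7];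
    the denominator has modulus at least [1]. *)
Lemma rising_inv_expansion (k : nat) (P : list R) :
  (forall i, (i < 7)%nat ->
     nth i (padd (monomial k) (pscale (-1) (pmul P (rising_poly k)))) 0 = 0) ->
  exists M, 0 <= M /\ forall nu, 1 <= nu ->
    Cmod (/ rising nu k - peval P (/ (Ci * RtoC nu)))%C <= M / nu ^ 7.
Proof.
  intros H. destruct (peval_low_order 7 _ H) as [M [HM B]].
  exists M. split; [exact HM|]. intros nu Hnu. set (w := (/ (Ci * RtoC nu))%C).
  assert (Hw : Cmod w = / nu) by (now apply Cmod_recip).
  assert (Hw1 : Cmod w <= 1).
  { rewrite Hw, <- Rinv_1. apply Rinv_le_contravar; lra. }
  specialize (B w Hw1).
  pose proof (rising_poly_ge_1 nu k Hnu) as D. fold w in D.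
  pose proof (rising_scaled nu k Hnu) as E. fold w in E.
  rewrite peval_add, peval_scale, peval_mul, peval_monomial in B.
  set (d := peval (rising_poly k) w) in *.
  assert (Hd : d <> 0) by (apply Cmod_neq_0; lra).
  assert (Hr : rising nu k <> 0).
  { intros E0. apply Hd. rewrite <- E, E0. ring. }
  assert (Hwk : (w ^ k)%C <> 0).
  { intros E0. apply Hd. rewrite <- E, E0. ring. }
  replace (/ rising nu k - peval P w)%C with ((w ^ k + RtoC (-1) * (peval P w * d)) / d)%C.
  2:{ rewrite <- E. field. split; assumption. }
  rewrite Cmod_div by exact Hd. rewrite Hw, pow_inv in B.
  unfold Rdiv. apply Rmult_le_reg_r with (Cmod d); [lra|].
  rewrite Rmult_assoc, Rinv_l, Rmult_1_r by lra.
  eapply Rle_trans; [exact B|].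
  rewrite <- (Rmult_1_r (M * / nu ^ 7)) at 1. apply Rmult_le_compat_l; [|exact D].
  apply Rmult_le_pos; [exact HM|]. left. apply Rinv_0_lt_compat, pow_lt. lra.
Qed.

(** The coefficient of [w^(k + j)] is [(-1)^j] times the Stirling number of the second
    kind [S (k + j, k)]. *)
Definition rising_inv (k : nat) : list R :=
  match k with
  | 0 => [1]
  | 1 => [0; 1; -1; 1; -1; 1; -1]
  | 2 => [0; 0; 1; -3; 7; -15; 31]
  | 3 => [0; 0; 0; 1; -6; 25; -90]
  | 4 => [0; 0; 0; 0; 1; -10; 65]
  | 5 => [0; 0; 0; 0; 0; 1; -15]
  | 6 => [0; 0; 0; 0; 0; 0; 1]
  | _ => []
  end.

Lemma rising_inv_correct (k : nat) : (k <= 6)%nat ->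
  exists M, 0 <= M /\ forall nu, 1 <= nu ->
    Cmod (/ rising nu k - peval (rising_inv k) (/ (Ci * RtoC nu)))%C <= M / nu ^ 7.
Proof.
  intros Hk. apply rising_inv_expansion. intros i Hi.
  do 7 (destruct k as [|k];
    [do 7 (destruct i as [|i]; [simpl; ring|]); lia|]). lia.
Qed.

(** The last entry is the next polynomial of the family [Cpoly]; it brings the error
    down to [O (w^7)], and being the coefficient of the real number [w^6] it does not
    disturb the phase. *)
Definition series_poly (c : R) : list R :=
  [Cpoly 0 c; Cpoly 1 c; Cpoly 2 c; Cpoly 3 c; Cpoly 4 c; Cpoly 5 c;
   - c + 31 / 2 * c ^ 2 - 15 * c ^ 3 + 65 / 24 * c ^ 4 - / 8 * c ^ 5 + c ^ 6 / 720].

Lemma series_expansion (c : R) : 0 <= c ->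
  exists M, 0 <= M /\ forall nu, 1 <= nu -> exists s,
    is_series (K := C_AbsRing) (V := C_NormedModule) (series_term c nu) s
    /\ Cmod (s - peval (series_poly c) (/ (Ci * RtoC nu)))%C <= M / nu ^ 7.
Proof.
  intros Hc.
  assert (T : forall k, (k <= 6)%nat -> exists M, 0 <= M /\ forall nu, 1 <= nu ->
    Cmod (series_term c nu k
      - RtoC (c ^ k / INR (fact k)) * peval (rising_inv k) (/ (Ci * RtoC nu)))%C <= M / nu ^ 7).
  { intros k Hk. destruct (rising_inv_correct k Hk) as [M [HM B]].
    assert (P : 0 <= c ^ k / INR (fact k)).
    { apply Rdiv_le_0_compat; [now apply pow_le|apply INR_fact_lt_0]. }
    exists (c ^ k / INR (fact k) * M). split; [now apply Rmult_le_pos|].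
    intros nu Hnu. unfold series_term, Cdiv.
    match goal with |- Cmod (?a * ?b - ?a * ?d)%C <= _ =>
      replace (a * b - a * d)%C with (a * (b - d))%C by ring end.
    rewrite Cmod_mult, Cmod_R, Rabs_pos_eq by exact P.
    unfold Rdiv at 2. rewrite Rmult_assoc. apply Rmult_le_compat_l; [exact P|]. now apply B. }
  destruct (T 0%nat) as [M0 [P0 T0]]; [lia|]. destruct (T 1%nat) as [M1 [P1 T1]]; [lia|].
  destruct (T 2%nat) as [M2 [P2 T2]]; [lia|]. destruct (T 3%nat) as [M3 [P3 T3]]; [lia|].
  destruct (T 4%nat) as [M4 [P4 T4]]; [lia|]. destruct (T 5%nat) as [M5 [P5 T5]]; [lia|].
  destruct (T 6%nat) as [M6 [P6 T6]]; [lia|]. clear T.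
  exists (exp c + M0 + M1 + M2 + M3 + M4 + M5 + M6).
  split; [pose proof (exp_pos c); lra|].
  intros nu Hnu. destruct (series_tail c nu Hc Hnu) as [s [Hs Bs]].
  exists s. split; [exact Hs|].
  specialize (T0 nu Hnu). specialize (T1 nu Hnu). specialize (T2 nu Hnu).
  specialize (T3 nu Hnu). specialize (T4 nu Hnu). specialize (T5 nu Hnu). specialize (T6 nu Hnu).
  set (w := (/ (Ci * RtoC nu))%C) in *.
  assert (E : sum_n (series_term c nu) 6 = (series_term c nu 0 + series_term c nu 1
    + series_term c nu 2 + series_term c nu 3 + series_term c nu 4 + series_term c nu 5
    + series_term c nu 6)%C).
  { rewrite !sum_Sn, sum_O. reflexivity. }
  rewrite E in Bs.
  set (d0 := (series_term c nu 0 - _)%C) in T0. set (d1 := (series_term c nu 1 - _)%C) in T1.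
  set (d2 := (series_term c nu 2 - _)%C) in T2. set (d3 := (series_term c nu 3 - _)%C) in T3.
  set (d4 := (series_term c nu 4 - _)%C) in T4. set (d5 := (series_term c nu 5 - _)%C) in T5.
  set (d6 := (series_term c nu 6 - _)%C) in T6.
  set (d := (s - _)%C) in Bs.
  replace (s - peval (series_poly c) w)%C with (d + d0 + d1 + d2 + d3 + d4 + d5 + d6)%C.
  - pose proof (Cmod_triangle (d + d0 + d1 + d2 + d3 + d4 + d5) d6).
    pose proof (Cmod_triangle (d + d0 + d1 + d2 + d3 + d4) d5).
    pose proof (Cmod_triangle (d + d0 + d1 + d2 + d3) d4).
    pose proof (Cmod_triangle (d + d0 + d1 + d2) d3).
    pose proof (Cmod_triangle (d + d0 + d1) d2).
    pose proof (Cmod_triangle (d + d0) d1). pose proof (Cmod_triangle d d0).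
    unfold Rdiv in *. lra.
  - unfold d, d0, d1, d2, d3, d4, d5, d6.
    replace (peval (series_poly c) w) with
      (RtoC (c ^ 0 / INR (fact 0)) * peval (rising_inv 0) w
       + RtoC (c ^ 1 / INR (fact 1)) * peval (rising_inv 1) w
       + RtoC (c ^ 2 / INR (fact 2)) * peval (rising_inv 2) w
       + RtoC (c ^ 3 / INR (fact 3)) * peval (rising_inv 3) w
       + RtoC (c ^ 4 / INR (fact 4)) * peval (rising_inv 4) w
       + RtoC (c ^ 5 / INR (fact 5)) * peval (rising_inv 5) w
       + RtoC (c ^ 6 / INR (fact 6)) * peval (rising_inv 6) w)%C; [ring|].
    rewrite <- !peval_scale, <- !peval_add. f_equal.
    unfold series_poly. cbn -[INR pow Cpoly]. rewrite !INR_IZR_INZ. cbn -[pow Cpoly].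
    repeat (apply (f_equal2 cons); [unfold Cpoly; field|]). reflexivity.
Qed.

(** * The argument of the series factor *)

Fixpoint pcomp (p q : list R) : list R :=
  match p with
  | nil => nil
  | a :: p => padd [a] (pmul q (pcomp p q))
  end.

Lemma peval_comp (p q : list R) (w : C) : peval (pcomp p q) w = peval p (peval q w).
Proof.
  induction p as [|a p IH]; [reflexivity|].
  cbn [pcomp]. rewrite peval_add, peval_mul, IH. simpl. ring.
Qed.

(** With [w = 1/(i nu)] this is [i (a0/nu + a1/nu^3 + a2/nu^5)]. *)
Definition phase_poly (a0 a1 a2 : R) : list R := [0; - a0; 0; a1; 0; - a2].

(** At imaginary [w] the coefficients of odd order are those that produce an imaginary
    part, and the constant one dominates the real part. *)
Lemma phase_coefs (s1 s2 s3 s4 s5 s6 a0 a1 a2 : R) :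
  let p := pmul [1; s1; s2; s3; s4; s5; s6] (pcomp exp_poly (phase_poly a0 a1 a2)) in
  nth 0 p 0 = 1 /\ nth 1 p 0 = s1 - a0 /\
  nth 3 p 0 = s3 - a0 * s2 + a0 ^ 2 / 2 * s1 + (a1 - a0 ^ 3 / 6) /\
  nth 5 p 0 = s5 - a0 * s4 + a0 ^ 2 / 2 * s3 + (a1 - a0 ^ 3 / 6) * s2
    + (a0 ^ 4 / 24 - a0 * a1) * s1 + (- a2 + a0 ^ 2 * a1 / 2 - a0 ^ 5 / 120).
Proof.
  intros p.
  split; [|split; [|split]].
  - cbv -[Rplus Rmult Rminus Ropp Rinv Rdiv pow IZR]. field.
  - cbv -[Rplus Rmult Rminus Ropp Rinv Rdiv pow IZR]. field.
  - cbv -[Rplus Rmult Rminus Ropp Rinv Rdiv pow IZR]. field.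
  - cbv -[Rplus Rmult Rminus Ropp Rinv Rdiv pow IZR]. field.
Qed.

Lemma nth_padd (p q : list R) (i : nat) : nth i (padd p q) 0 = nth i p 0 + nth i q 0.
Proof.
  revert q i. induction p as [|a p IH]; intros q i.
  - simpl. destruct i; ring.
  - destruct q as [|b q]; destruct i as [|i]; simpl; try ring. apply IH.
Qed.

(** At the imaginary point [- i h] even powers are real, so the imaginary part starts
    with the first odd coefficient that does not vanish. *)
Lemma peval_odd_vanishing (p : list R) :
  nth 1 p 0 = 0 -> nth 3 p 0 = 0 -> nth 5 p 0 = 0 ->
  exists M, 0 <= M /\ forall h, 0 < h <= 1 ->
    Rabs (Im (peval p (- Ci * RtoC h)%C)) <= M * h ^ 7 /\
    Rabs (Re (peval p (- Ci * RtoC h)%C) - nth 0 p 0) <= M * h.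
Proof.
  intros H1 H3 H5.
  set (n0 := nth 0 p 0). set (n2 := nth 2 p 0). set (n4 := nth 4 p 0). set (n6 := nth 6 p 0).
  set (e := [- n0; 0; - n2; 0; - n4; 0; - n6]).
  destruct (peval_low_order 7 (padd p e)) as [M [HM B]].
  { intros i Hi. rewrite nth_padd.
    do 7 (destruct i as [|i]; [simpl nth at 2; try rewrite H1; try rewrite H3; try rewrite H5;
      unfold n0, n2, n4, n6; ring|]). lia. }
  exists (M + Rabs n2 + Rabs n4 + Rabs n6).
  pose proof (Rabs_pos n2). pose proof (Rabs_pos n4). pose proof (Rabs_pos n6).
  split; [lra|]. intros h Hh. set (w := (- Ci * RtoC h)%C).
  assert (Hw : Cmod w = h).
  { unfold w. rewrite Cmod_mult, Cmod_opp, Cmod_Ci, Cmod_R, Rabs_pos_eq by lra. ring. }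
  specialize (B w ltac:(lra)). rewrite peval_add, Hw in B.
  set (v := n2 * h ^ 2 - n4 * h ^ 4 + n6 * h ^ 6).
  assert (Ee : peval e w = RtoC (- n0 + v)).
  { unfold e, w, v. apply injective_projections; simpl; ring. }
  rewrite Ee in B. set (P := peval p w) in *.
  assert (h7 : 0 <= h ^ 7 <= h).
  { split; [apply pow_le; lra|]. replace h with (h ^ 1) at 2 by ring.
    replace (h ^ 7) with (h ^ 1 * h ^ 6) by ring.
    assert (h ^ 6 <= 1) by (rewrite <- (pow1 6); apply pow_incr; lra).
    simpl in *. nra. }
  pose proof (re_le_Cmod (P + RtoC (- n0 + v))%C) as R1.
  pose proof (im_le_Cmod (P + RtoC (- n0 + v))%C) as R2.
  replace (Re (P + RtoC (- n0 + v))%C) with (Re P - n0 + v) in R1 by (unfold Re; simpl; ring).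
  replace (Im (P + RtoC (- n0 + v))%C) with (Im P) in R2 by (unfold Im; simpl; ring).
  split.
  - eapply Rle_trans; [exact R2|]. eapply Rle_trans; [exact B|].
    apply Rmult_le_compat_r; lra.
  - assert (Hv : Rabs v <= (Rabs n2 + Rabs n4 + Rabs n6) * h).
    { assert (Hk : forall k, Rabs (h ^ S k) <= h).
      { intros k. rewrite Rabs_pos_eq by (apply pow_le; lra). simpl.
        assert (h ^ k <= 1) by (rewrite <- (pow1 k); apply pow_incr; lra). nra. }
      unfold v.
      replace (n2 * h ^ 2 - n4 * h ^ 4 + n6 * h ^ 6)
        with (n2 * h ^ 2 + (- n4 * h ^ 4) + n6 * h ^ 6) by ring.
      eapply Rle_trans; [apply Rabs_triang|].
      eapply Rle_trans; [apply Rplus_le_compat_r, Rabs_triang|].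
      rewrite !Rabs_mult, Rabs_Ropp.
      pose proof (Rmult_le_compat_l _ _ _ H (Hk 1%nat)).
      pose proof (Rmult_le_compat_l _ _ _ H0 (Hk 3%nat)).
      pose proof (Rmult_le_compat_l _ _ _ H2 (Hk 5%nat)). lra. }
    replace (Re P - n0) with ((Re P - n0 + v) + - v) by ring.
    eapply Rle_trans; [apply Rabs_triang|]. rewrite Rabs_Ropp.
    assert (M * h ^ 7 <= M * h) by (apply Rmult_le_compat_l; lra). lra.
Qed.

Lemma acoef_expand (x : R) :
  let c := x ^ 2 / 4 in
  acoef x 1 = Cpoly 1 c + stirling 1 /\
  acoef x 2 = Cpoly 2 c + (stirling 1 * Cpoly 1 c + stirling 2) /\
  acoef x 3 = Cpoly 3 c + (stirling 1 * Cpoly 2 c + stirling 2 * Cpoly 1 c + stirling 3) /\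
  acoef x 4 = Cpoly 4 c + (stirling 1 * Cpoly 3 c + stirling 2 * Cpoly 2 c
     + stirling 3 * Cpoly 1 c + stirling 4) /\
  acoef x 5 = Cpoly 5 c + (stirling 1 * Cpoly 4 c + stirling 2 * Cpoly 3 c
     + stirling 3 * Cpoly 2 c + stirling 4 * Cpoly 1 c + stirling 5).
Proof.
  intros c. unfold acoef. cbv zeta. fold c.
  repeat split; rewrite !sum_n_Sm by lia; rewrite sum_n_m_zero by lia;
    change (@plus R_AbelianMonoid) with Rplus; change (@zero R_AbelianMonoid) with 0;
    cbn [Nat.sub]; change (Cpoly 0 c) with 1; ring.
Qed.

(** The coefficients [A_j] contain Stirling's series; without it, the phase of the
    series factor alone is given by these. *)
Definition alpha0 (x : R) : R := A0 x + / 12.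
Definition alpha1 (x : R) : R := A1 x + / 360.
Definition alpha2 (x : R) : R := A2 x + / 1260.

(** This is the identity that determines [A0], [A1] and [A2]. *)
Lemma phase_coefs_vanish (x : R) :
  let p := pmul (series_poly (x ^ 2 / 4))
             (pcomp exp_poly (phase_poly (alpha0 x) (alpha1 x) (alpha2 x))) in
  nth 0 p 0 = 1 /\ nth 1 p 0 = 0 /\ nth 3 p 0 = 0 /\ nth 5 p 0 = 0.
Proof.
  intros p. unfold p, series_poly. change (Cpoly 0 (x ^ 2 / 4)) with 1.
  destruct (phase_coefs (Cpoly 1 (x ^ 2 / 4)) (Cpoly 2 (x ^ 2 / 4)) (Cpoly 3 (x ^ 2 / 4))
    (Cpoly 4 (x ^ 2 / 4)) (Cpoly 5 (x ^ 2 / 4))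
    (- (x ^ 2 / 4) + 31 / 2 * (x ^ 2 / 4) ^ 2 - 15 * (x ^ 2 / 4) ^ 3 + 65 / 24 * (x ^ 2 / 4) ^ 4
       - / 8 * (x ^ 2 / 4) ^ 5 + (x ^ 2 / 4) ^ 6 / 720) (alpha0 x) (alpha1 x) (alpha2 x))
    as (E0 & E1 & E3 & E5).
  rewrite E0, E1, E3, E5. clear.
  unfold alpha0, alpha1, alpha2, A0, A1, A2.
  destruct (acoef_expand x) as (a1 & a2 & a3 & a4 & a5). rewrite a1, a2, a3, a4, a5.
  generalize (x ^ 2 / 4). intros c. unfold Cpoly, stirling.
  repeat split; field.
Qed.

(** Minus the argument of the series factor, up to [O (nu^-7)]. *)
Definition series_phase (x nu : R) : R :=
  alpha0 x / nu + alpha1 x / nu ^ 3 + alpha2 x / nu ^ 5.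

Lemma series_rotated (x : R) :
  exists M N, 2 <= N /\ 0 <= M /\ forall nu, N <= nu -> exists s,
    is_series (K := C_AbsRing) (V := C_NormedModule) (series_term (x ^ 2 / 4) nu) s /\
    Rabs (Im (s * cis (series_phase x nu))%C) <= M / nu ^ 7 /\
    / 2 <= Re (s * cis (series_phase x nu))%C.
Proof.
  set (c := x ^ 2 / 4).
  assert (Hc : 0 <= c) by (unfold c; pose proof (pow2_ge_0 x); lra).
  set (G := Rabs (alpha0 x) + Rabs (alpha1 x) + Rabs (alpha2 x)).
  assert (HG : 0 <= G).
  { unfold G. pose proof (Rabs_pos (alpha0 x)). pose proof (Rabs_pos (alpha1 x)).
    pose proof (Rabs_pos (alpha2 x)). lra. }
  destruct (series_expansion c Hc) as [M1 [HM1 B1]].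
  destruct (peval_bounded (series_poly c)) as [M2 [HM2 B2]].
  destruct (phase_coefs_vanish x) as (V0 & V1 & V3 & V5). fold c in V0, V1, V3, V5.
  destruct (peval_odd_vanishing _ V1 V3 V5) as [M3 [HM3 B3]].
  rewrite V0 in B3.
  set (K := M1 + M2 * (G ^ 7 + G ^ 8)).
  assert (HK : 0 <= K).
  { unfold K. pose proof (pow_le G 7 HG). pose proof (pow_le G 8 HG). nra. }
  (* the real part differs from 1 by at most (K + M3) / nu *)
  exists (K + M3), (2 + 2 * (K + M3)). split; [lra|]. split; [lra|].
  intros nu Hnu. assert (Hnu1 : 1 <= nu) by lra.
  destruct (B1 nu Hnu1) as [s [Hs Bs]]. exists s. split; [exact Hs|].
  set (h := / nu). assert (Hh : 0 < h <= 1).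
  { unfold h. split; [apply Rinv_0_lt_compat; lra|]. rewrite <- Rinv_1. apply Rinv_le_contravar; lra. }
  assert (Hnh : nu * h = 1) by (unfold h; field; lra).
  assert (Ew : (/ (Ci * RtoC nu))%C = (- Ci * RtoC h)%C).
  { unfold h. rewrite RtoC_inv by lra.
    replace (/ (Ci * RtoC nu))%C with (/ Ci * / RtoC nu)%C; [now rewrite Ci_inv|].
    field. split; intros E; injection E; lra. }
  rewrite Ew in Bs. set (w := (- Ci * RtoC h)%C) in *.
  set (g := series_phase x nu).
  assert (Eg : g = alpha0 x * h + alpha1 x * h ^ 3 + alpha2 x * h ^ 5).
  { unfold g, series_phase, h. field. lra. }
  assert (Eu : (Ci * RtoC g)%C = peval (phase_poly (alpha0 x) (alpha1 x) (alpha2 x)) w).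
  { rewrite Eg. unfold w. apply injective_projections; simpl; ring. }
  assert (Bg : Rabs g <= G * h).
  { assert (Hk : forall k, 0 <= h ^ S k <= h).
    { intros k. split; [apply pow_le; lra|]. simpl.
      assert (0 <= h ^ k <= 1).
      { split; [apply pow_le; lra|rewrite <- (pow1 k); apply pow_incr; lra]. } nra. }
    rewrite Eg. eapply Rle_trans; [apply Rabs_triang|].
    eapply Rle_trans; [apply Rplus_le_compat_r, Rabs_triang|].
    rewrite !Rabs_mult. rewrite (Rabs_pos_eq h) by lra.
    rewrite (Rabs_pos_eq (h ^ 3)) by apply Hk. rewrite (Rabs_pos_eq (h ^ 5)) by apply Hk.
    pose proof (Rmult_le_compat_l _ _ _ (Rabs_pos (alpha1 x)) (proj2 (Hk 2%nat))).
    pose proof (Rmult_le_compat_l _ _ _ (Rabs_pos (alpha2 x)) (proj2 (Hk 4%nat))).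
    unfold G. lra. }
  assert (h7 : 0 <= h ^ 7) by (apply pow_le; lra).
  assert (BE : Cmod (cis g - peval exp_poly (Ci * RtoC g))%C <= (G ^ 7 + G ^ 8) * h ^ 7).
  { eapply Rle_trans; [apply cis_taylor|].
    assert (Rabs g ^ 7 <= G ^ 7 * h ^ 7).
    { rewrite <- Rpow_mult_distr. apply pow_incr. split; [apply Rabs_pos|exact Bg]. }
    assert (Rabs g ^ 8 <= G ^ 8 * h ^ 8).
    { rewrite <- Rpow_mult_distr. apply pow_incr. split; [apply Rabs_pos|exact Bg]. }
    assert (h ^ 8 <= h ^ 7) by (change (h ^ 8) with (h * h ^ 7); nra).
    pose proof (Rmult_le_compat_l _ _ _ (pow_le G 8 HG) H1). lra. }
  rewrite Eu in BE. rewrite <- peval_comp in BE.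
  assert (Hw : Cmod w <= 1).
  { unfold w. rewrite Cmod_mult, Cmod_opp, Cmod_Ci, Cmod_R, Rabs_pos_eq; lra. }
  destruct (B3 h Hh) as [B4 B5]. fold w in B4, B5. rewrite peval_mul in B4, B5.
  set (pS := peval (series_poly c) w) in *.
  set (pE := peval (pcomp exp_poly _) w) in *.
  assert (D : Cmod (s * cis g - pS * pE)%C <= K * h ^ 7).
  { replace (s * cis g - pS * pE)%C with ((s - pS) * cis g + pS * (cis g - pE))%C by ring.
    eapply Rle_trans; [apply Cmod_triangle|]. rewrite !Cmod_mult, Cmod_cis.
    unfold Rdiv in Bs. rewrite <- pow_inv in Bs. fold h in Bs.
    pose proof (Rmult_le_compat _ _ _ _ (Cmod_ge_0 pS) (Cmod_ge_0 (cis g - pE)%C) (B2 w Hw) BE).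
    unfold K. lra. }
  pose proof (re_le_Cmod (s * cis g - pS * pE)%C) as R1.
  pose proof (im_le_Cmod (s * cis g - pS * pE)%C) as R2.
  change (Re (s * cis g - pS * pE)%C) with (Re (s * cis g)%C - Re (pS * pE)%C) in R1.
  rewrite im_minus in R2.
  unfold Rdiv. rewrite <- pow_inv. fold h.
  set (Z := (s * cis g)%C) in *. set (Y := (pS * pE)%C) in *.
  split.
  - replace (Im Z) with ((Im Z - Im Y) + Im Y) by ring.
    eapply Rle_trans; [apply Rabs_triang|]. lra.
  - assert (h7h : h ^ 7 <= h).
    { change (h ^ 7) with (h * h ^ 6).
      assert (0 <= h ^ 6 <= 1).
      { split; [apply pow_le; lra|rewrite <- (pow1 6); apply pow_incr; lra]. } nra. }
    assert (K * h ^ 7 <= K * h) by (apply Rmult_le_compat_l; lra).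
    apply Rabs_le_between in B5.
    assert (T : Rabs (Re Z - Re Y) <= K * h) by lra.
    apply Rabs_le_between in T.
    assert ((K + M3) * h <= / 2).
    { apply Rmult_le_reg_r with (2 * nu); [lra|].
      replace ((K + M3) * h * (2 * nu)) with (2 * (K + M3) * (nu * h)) by ring.
      rewrite Hnh. lra. }
    lra.
Qed.

(** * The condition satisfied by the zeros *)

Lemma Gamma_Gm_0 (nu : R) : Gamma (1 + Ci * nu) = Gm 0 nu.
Proof.
  rewrite <- Gamma_Gm. f_equal. simpl. ring.
Qed.

Lemma Gm_opp (nu : R) (k : nat) : Gm k (- nu) = Cconj (Gm k nu).
Proof.
  unfold Gm, Cconj. cbn [fst snd]. apply injective_projections; cbn [fst snd].
  - apply (is_RInt_pos_unique (fun t => t ^ k * exp (- t) * cos (- nu * ln t))); [apply gammaC_correct|].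
    eapply is_RInt_pos_ext; [|apply gammaC_correct]. intros t _.
    replace (- nu * ln t) with (- (nu * ln t)) by ring. now rewrite cos_neg.
  - apply (is_RInt_pos_unique (fun t => t ^ k * exp (- t) * sin (- nu * ln t))); [apply gammaS_correct|].
    eapply is_RInt_pos_ext; [|apply (is_RInt_gen_opp (V := R_NormedModule)), gammaS_correct].
    intros t _. replace (- nu * ln t) with (- (nu * ln t)) by ring. rewrite sin_neg.
    unfold opp; simpl. ring.
Qed.

Lemma CSeries_unique (a : nat -> C) (s : C) :
  is_series (K := C_AbsRing) (V := C_NormedModule) a s -> CSeries a = s.
Proof.
  intros H. unfold CSeries. apply (iota_unique (V := C_CompleteNormedModule)); [|exact H].
  intros y Hy. apply (filterlim_locally_unique (K := C_AbsRing) (V := C_NormedModule) (sum_n a) y s Hy H).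
Qed.

(** Needed for [I_{-i nu}], whose terms are the conjugates of those of
    [I_{i nu}]. *)
Lemma is_series_conj (a : nat -> C) (s : C) :
  is_series (K := C_AbsRing) (V := C_NormedModule) a s ->
  is_series (K := C_AbsRing) (V := C_NormedModule) (fun k => Cconj (a k)) (Cconj s).
Proof.
  intros H. unfold is_series.
  apply filterlim_ext with (fun n => Cconj (sum_n a n)).
  { induction x as [|n IH]; [now rewrite !sum_O|].
    rewrite !sum_Sn, <- IH. apply Cplus_conj. }
  apply (filterlim_comp _ _ _ (sum_n a) Cconj _ (locally s)); [exact H|].
  apply filterlim_locally. intros eps. exists eps. intros y [Hy1 Hy2]. split; [exact Hy1|].
  change (Rabs (- snd y - - snd s) < eps). change (Rabs (snd y - snd s) < eps) in Hy2.
  replace (- snd y - - snd s) with (- (snd y - snd s)) by ring. now rewrite Rabs_Ropp.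
Qed.

Lemma rcpow_imag (t nu : R) : 0 < t -> rcpow t (Ci * nu) = cis (nu * ln t).
Proof.
  intros Ht. unfold rcpow, cis.
  replace (Re (Ci * nu)) with 0 by (unfold Re; simpl; ring).
  replace (Im (Ci * nu)) with nu by (unfold Im; simpl; ring).
  rewrite Rpower_O by exact Ht. now rewrite !Rmult_1_l.
Qed.

Definition bessel_term (x nu : R) (k : nat) : C :=
  (RtoC ((x ^ 2 / 4) ^ k / INR (fact k)) / (Gm k nu / Gm 0 nu))%C.

Lemma besselI_imag (x nu : R) (s : C) : 0 < x -> (forall k, Gm k nu <> 0) ->
  is_series (K := C_AbsRing) (V := C_NormedModule) (bessel_term x nu) s ->
  besselI (Ci * nu) x = (cis (nu * ln (x / 2)) / Gm 0 nu * s)%C.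
Proof.
  intros Hx HG Hs. unfold besselI.
  replace (x / 2)%C with (RtoC (x / 2)) by (unfold Rdiv; rewrite RtoC_mult, RtoC_inv by lra; reflexivity).
  rewrite rcpow_imag by lra. rewrite Gamma_Gm_0. f_equal.
  apply CSeries_unique. apply is_series_ext with (2 := Hs). intros k.
  unfold bessel_term, poch. rewrite Gamma_Gm, Gamma_Gm_0.
  rewrite <- RtoC_pow, pow_mult. replace ((x / 2) ^ 2) with (x ^ 2 / 4) by field.
  pose proof (INR_fact_neq_0 k) as HF.
  unfold Rdiv. rewrite RtoC_mult, RtoC_inv by exact HF.
  assert (HF' : RtoC (INR (fact k)) <> 0) by (intros E; injection E; exact HF).
  match goal with |- ?a = ?b => change (@eq C a b) end.
  field. repeat split; trivial.
Qed.

Lemma Cconj_neq_0 (z : C) : z <> 0 -> Cconj z <> 0.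
Proof. intros H E. apply H. rewrite <- (Cconj_conj z), E. apply injective_projections; simpl; ring. Qed.

Lemma cis_opp (a : R) : cis (- a) = Cconj (cis a).
Proof. unfold cis, Cconj. cbn [fst snd]. now rewrite cos_neg, sin_neg. Qed.

Lemma besselI_conj (x nu : R) (s : C) : 0 < x -> (forall k, Gm k nu <> 0) ->
  is_series (K := C_AbsRing) (V := C_NormedModule) (bessel_term x nu) s ->
  besselI (- (Ci * nu)) x = Cconj (besselI (Ci * nu) x).
Proof.
  intros Hx HG Hs. rewrite (besselI_imag x nu s Hx HG Hs).
  replace (- (Ci * nu))%C with (Ci * RtoC (- nu))%C by (rewrite RtoC_opp; ring).
  rewrite (besselI_imag x (- nu) (Cconj s) Hx).
  - rewrite Cmult_conj, Cdiv_conj by apply HG.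
    rewrite Gm_opp. replace (- nu * ln (x / 2)) with (- (nu * ln (x / 2))) by ring.
    now rewrite cis_opp.
  - intros k. rewrite Gm_opp. now apply Cconj_neq_0.
  - apply is_series_ext with (2 := is_series_conj _ _ Hs). intros k.
    unfold bessel_term. rewrite !Gm_opp, !Cdiv_conj; trivial.
    + f_equal. apply injective_projections; simpl; ring.
    + intros E. apply (HG k). replace (Gm k nu) with (Gm k nu / Gm 0 nu * Gm 0 nu)%C by (field; apply HG).
      rewrite E. ring.
Qed.

Lemma Lfun_zero_re (x nu : R) (s : C) : 0 < x -> 0 < nu -> (forall k, Gm k nu <> 0) ->
  is_series (K := C_AbsRing) (V := C_NormedModule) (bessel_term x nu) s ->
  Lfun x nu = RtoC 0 -> Re (besselI (Ci * nu) x) = 0.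
Proof.
  intros Hx Hnu HG Hs H. unfold Lfun in H. rewrite (besselI_conj x nu s Hx HG Hs) in H.
  set (b := besselI (Ci * nu) x) in *.
  assert (Hsh : 0 < sinh (PI * nu)).
  { unfold sinh. assert (exp (- (PI * nu)) < exp (PI * nu)); [|lra].
    apply exp_increasing. pose proof PI_RGT_0. nra. }
  apply (f_equal Re) in H.
  replace (Re (RtoC (PI / (2 * sinh (PI * nu))) * (b + Cconj b))%C)
    with (PI / (2 * sinh (PI * nu)) * (2 * Re b)) in H by (unfold Re, Cconj; simpl; ring).
  change (Re (RtoC 0)) with 0 in H.
  apply Rmult_integral in H. destruct H as [H|H]; [|lra].
  exfalso. revert H. apply Rgt_not_eq. apply Rdiv_lt_0_compat; [apply PI_RGT_0|lra].
Qed.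

(** Minus the argument of [I_{i nu} (x)], up to [O (nu^-7)]. *)
Definition phase (x nu : R) : R := Phi x nu + (A0 x / nu + A1 x / nu ^ 3 + A2 x / nu ^ 5).

Lemma phase_decomposition (x nu : R) : 0 < x -> 0 < nu ->
  nu * ln (x / 2) - stirling_arg nu 0 - series_phase x nu = - phase x nu.
Proof.
  intros Hx Hnu. rewrite stirling_arg_zero by exact Hnu.
  unfold phase, Phi, series_phase, lambda, alpha0, alpha1, alpha2.
  pose proof (exp_pos 1) as He.
  replace (2 / (exp 1 * x) * nu) with (nu / (exp 1 * (x / 2))) by (field; split; lra).
  rewrite (ln_div nu) by (try apply Rmult_lt_0_compat; lra).
  rewrite ln_mult by lra. rewrite ln_exp. field. lra.
Qed.

(** Up to a positive factor, [I_{i nu} (x)] is [cis (- phase - e) * P] where [e] is the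
    error of [gamma_angle] and [P] is the rotated series factor, which is real and
    at least [1/2] up to an imaginary part [O (nu^-7)].  Its real part vanishes only
    if the cosine of the phase is of the same size as these errors. *)
Lemma zero_condition (x : R) : 0 < x ->
  exists M N, 2 <= N /\ 0 <= M /\ forall nu, N <= nu -> Lfun x nu = RtoC 0 ->
    Rabs (cos (phase x nu)) <= M / nu ^ 7.
Proof.
  intros Hx. destruct (series_rotated x) as [M [N [HN [HM H]]]].
  exists (2 * M + 1760), N. split; [exact HN|]. split; [lra|].
  intros nu Hnu HL. destruct (H nu Hnu) as [s [Hs [HI HR]]].
  assert (Hnu2 : 2 <= nu) by lra.
  destruct (gamma_angle nu Hnu2) as [q [e [Hq [He HG]]]].
  assert (HG0 : Gm 0 nu <> 0).
  { rewrite HG. apply Cmod_neq_0. rewrite Cmod_mult, Cmod_cis, Cmod_R, Rabs_pos_eq; lra. }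
  assert (Hris : forall k, rising nu k <> 0).
  { intros k. apply Cmod_neq_0. pose proof (Cmod_rising_ge nu k ltac:(lra)).
    pose proof (pow_lt nu k ltac:(lra)). lra. }
  assert (HGk : forall k, Gm k nu <> 0).
  { intros k. rewrite Gm_rising. now apply Cmult_neq_0. }
  assert (Hs' : is_series (K := C_AbsRing) (V := C_NormedModule) (bessel_term x nu) s).
  { apply is_series_ext with (2 := Hs). intros k. unfold bessel_term, series_term.
    rewrite (Gm_rising nu k).
    match goal with |- ?a = ?b => change (@eq C a b) end.
    field. split; [exact HG0|apply Hris]. }
  pose proof (Lfun_zero_re x nu s Hx ltac:(lra) HGk Hs' HL) as Z.
  rewrite (besselI_imag x nu s Hx HGk Hs') in Z.
  set (g := series_phase x nu) in *. set (P := (s * cis g)%C) in *.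
  set (D := - (phase x nu + e)).
  assert (E : (cis (nu * ln (x / 2)) / Gm 0 nu * s)%C = (RtoC (/ q) * (cis D * P))%C).
  { rewrite HG, RtoC_inv by lra.
    assert (Hc : forall a, (/ cis a)%C = cis (- a)).
    { intros a. assert (Ha : cis a <> 0) by (apply Cmod_neq_0; rewrite Cmod_cis; lra).
      replace (cis (- a)) with (/ cis a * (cis a * cis (- a)))%C by (field; exact Ha).
      rewrite <- cis_plus, Rplus_opp_r, cis_0. ring. }
    assert (Hqc : RtoC q <> 0) by (intros E; injection E; lra).
    replace (cis (nu * ln (x / 2)) / (q * cis (stirling_arg nu 0 + e)) * s)%C
      with (/ q * (cis (nu * ln (x / 2)) * / cis (stirling_arg nu 0 + e) * s))%C.
    2:{ field. split; [|exact Hqc]. apply Cmod_neq_0. rewrite Cmod_cis. lra. }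
    rewrite Hc. f_equal. unfold P.
    replace D with (nu * ln (x / 2) + - (stirling_arg nu 0 + e) + - g).
    2:{ unfold D. pose proof (phase_decomposition x nu Hx ltac:(lra)). fold g in H0. lra. }
    rewrite !cis_plus.
    transitivity (cis (nu * ln (x / 2)) * cis (- (stirling_arg nu 0 + e)) * s * (cis (- g) * cis g))%C; [|ring].
    rewrite <- (cis_plus (- g) g), Rplus_opp_l, cis_0. ring. }
  rewrite E in Z.
  replace (Re (RtoC (/ q) * (cis D * P))%C) with (/ q * (cos D * Re P - sin D * Im P)) in Z
    by (unfold Re, Im, cis; simpl; ring).
  apply Rmult_integral in Z. destruct Z as [Z|Z].
  { exfalso. pose proof (Rinv_0_lt_compat q Hq). lra. }
  assert (HD : Rabs (cos D) <= 2 * (M / nu ^ 7)).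
  { assert (Z' : cos D * Re P = sin D * Im P) by lra.
    apply (f_equal Rabs) in Z'. rewrite !Rabs_mult in Z'.
    rewrite (Rabs_pos_eq (Re P)) in Z' by lra.
    pose proof (Rabs_sin_le D). pose proof (Rabs_pos (cos D)). pose proof (Rabs_pos (Im P)).
    pose proof (Rabs_pos (sin D)).
    assert (Rabs (cos D) * / 2 <= Rabs (cos D) * Re P) by (apply Rmult_le_compat_l; lra).
    assert (Rabs (sin D) * Rabs (Im P) <= 1 * Rabs (Im P)) by (apply Rmult_le_compat_r; lra).
    lra. }
  unfold D in HD. rewrite cos_neg in HD.
  pose proof (cos_lipschitz (phase x nu) (phase x nu + e)) as Lc.
  replace (phase x nu - (phase x nu + e)) with (- e) in Lc by ring. rewrite Rabs_Ropp in Lc.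
  replace (cos (phase x nu)) with
    ((cos (phase x nu) - cos (phase x nu + e)) + cos (phase x nu + e)) by ring.
  eapply Rle_trans; [apply Rabs_triang|]. unfold Rdiv in *. lra.
Qed.

(** * Implicit expansion with uniform bounds *)

Lemma Rabs_plus_le (a b A B : R) : Rabs a <= A -> Rabs b <= B -> Rabs (a + b) <= A + B.
Proof. intros. eapply Rle_trans; [apply Rabs_triang|lra]. Qed.

Lemma Rabs_minus_le (a b A B : R) : Rabs a <= A -> Rabs b <= B -> Rabs (a - b) <= A + B.
Proof.
  intros. unfold Rminus. apply Rabs_plus_le; [assumption|]. now rewrite Rabs_Ropp.
Qed.

Lemma Rabs_mult_le (a b A B : R) : Rabs a <= A -> Rabs b <= B -> Rabs (a * b) <= A * B.
Proof. intros. rewrite Rabs_mult. apply Rmult_le_compat; auto using Rabs_pos. Qed.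

Lemma Rabs_opp_le (a A : R) : Rabs a <= A -> Rabs (- a) <= A.
Proof. now rewrite Rabs_Ropp. Qed.

Lemma Rabs_pow_le (a A : R) (n : nat) : Rabs a <= A -> Rabs (a ^ n) <= A ^ n.
Proof. intros. rewrite <- RPow_abs. apply pow_incr. split; [apply Rabs_pos|assumption]. Qed.

Lemma Rabs_div_ge_1_le (a L A : R) : 1 <= L -> Rabs a <= A -> Rabs (a / L) <= A.
Proof.
  intros HL Ha. unfold Rdiv. rewrite Rabs_mult, Rabs_inv, (Rabs_pos_eq L) by lra.
  rewrite <- (Rmult_1_r A). apply Rmult_le_compat; [apply Rabs_pos| |exact Ha|].
  - left. apply Rinv_0_lt_compat. lra.
  - rewrite <- Rinv_1. apply Rinv_le_contravar; lra.
Qed.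

(** Bounds a polynomial expression in quantities bounded by constants.  Applied to a
    goal [Rabs e <= ?M] it constructs [M] from those constants alone, hence
    uniformly in all other variables. *)
Ltac bound :=
  repeat first
    [ eassumption | apply Rabs_plus_le | apply Rabs_minus_le | apply Rabs_opp_le
    | apply Rabs_pow_le | apply Rabs_mult_le ];
  try apply Rle_refl.

(** Newton-like elimination: from [y L = G (y, k) + k^3 r] one gets successively
    [y = b0 + k y1], [y1 = b1 + k y2], [y2 = b2 + k y3].  Each [y_j] is a polynomial in
    the previous quantities divided by [L >= 1], hence bounded uniformly in [L]; this
    matters because [L] tends to infinity with the index of the zero. *)
Lemma implicit_expansion (A0 A1 A2 Y M : R) :
  exists M', forall L y k r, 1 <= L -> Rabs y <= Y -> 0 < k <= 1 -> Rabs r <= M ->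
  y * L = - A0 * (1 - k * y + k ^ 2 * y ^ 2) - A1 * k * (1 - 3 * k * y) - A2 * k ^ 2
    - k * y ^ 2 / 2 + k ^ 2 * y ^ 3 / 6 + k ^ 3 * r ->
  let b0 := - A0 / L in
  let b1 := (A0 * b0 - A1 - 1 / 2 * b0 ^ 2) / L in
  let b2 := (3 * A1 * b0 - A0 * (b0 ^ 2 - b1) - A2 - b0 * b1 + 1 / 6 * b0 ^ 3) / L in
  Rabs (y - b0) <= M' * k /\
  Rabs (y - (b0 + k * b1)) <= M' * k ^ 2 /\
  Rabs (y - (b0 + k * b1 + k ^ 2 * b2)) <= M' * k ^ 3.
Proof.
  assert (H : exists Y1 Y2 Y3, forall L y k r,
    1 <= L -> Rabs y <= Y -> 0 < k <= 1 -> Rabs r <= M ->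
  y * L = - A0 * (1 - k * y + k ^ 2 * y ^ 2) - A1 * k * (1 - 3 * k * y) - A2 * k ^ 2
    - k * y ^ 2 / 2 + k ^ 2 * y ^ 3 / 6 + k ^ 3 * r ->
  let b0 := - A0 / L in
  let b1 := (A0 * b0 - A1 - 1 / 2 * b0 ^ 2) / L in
  let b2 := (3 * A1 * b0 - A0 * (b0 ^ 2 - b1) - A2 - b0 * b1 + 1 / 6 * b0 ^ 3) / L in
  exists y1 y2 y3, y = b0 + k * y1 /\ y1 = b1 + k * y2 /\ y2 = b2 + k * y3 /\
    Rabs y1 <= Y1 /\ Rabs y2 <= Y2 /\ Rabs y3 <= Y3).
  { eexists. eexists. eexists. intros L y k r HL Hy Hk Hr E b0 b1 b2.
    assert (Hk' : Rabs k <= 1) by (rewrite Rabs_pos_eq; lra).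
    assert (Hb0 : Rabs b0 <= Rabs A0) by (apply Rabs_div_ge_1_le; [exact HL|bound]).
    assert (Hb1 : Rabs b1 <= Rabs A0 * Rabs A0 + Rabs A1 + Rabs (1 / 2) * Rabs A0 ^ 2).
    { apply Rabs_div_ge_1_le; [exact HL|]. bound. }
    set (q := - A0 * y ^ 2 + 3 * A1 * y - A2 + y ^ 3 * / 6 + k * r).
    set (y1 := (A0 * y - A1 - y ^ 2 * / 2 + k * q) / L).
    eassert (B1 : Rabs y1 <= _).
    { unfold y1. apply Rabs_div_ge_1_le; [exact HL|]. unfold q. bound. }
    assert (L1 : y1 * L = A0 * y - A1 - y ^ 2 * / 2 + k * q) by (unfold y1; field; lra).
    clearbody y1.
    assert (E1 : k * y1 = y - b0).
    { apply Rmult_eq_reg_r with L; [|lra].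
      replace (k * y1 * L) with (k * (y1 * L)) by ring. rewrite L1.
      rewrite Rmult_minus_distr_r, E. unfold b0, q. field. lra. }
    set (y2 := (A0 * y1 - y1 * (y + b0) * / 2 + q) / L).
    eassert (B2 : Rabs y2 <= _).
    { unfold y2. apply Rabs_div_ge_1_le; [exact HL|]. unfold q. bound. }
    assert (L2 : y2 * L = A0 * y1 - y1 * (y + b0) * / 2 + q) by (unfold y2; field; lra).
    clearbody y2.
    assert (E2 : k * y2 = y1 - b1).
    { apply Rmult_eq_reg_r with L; [|lra].
      replace (k * y2 * L) with (k * (y2 * L)) by ring.
      rewrite Rmult_minus_distr_r, L1, L2.
      replace (b1 * L) with (A0 * b0 - A1 - 1 / 2 * b0 ^ 2) by (unfold b1; field; lra).
      replace (k * (A0 * y1 - y1 * (y + b0) * / 2 + q))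
        with (A0 * (k * y1) - k * y1 * (y + b0) * / 2 + k * q) by ring.
      rewrite E1. field. }
    set (y3 := (A0 * y2 - (y2 * (y + b0) + b1 * y1) * / 2 - A0 * (y1 * (y + b0)) + 3 * A1 * y1
        + y1 * (y ^ 2 + y * b0 + b0 ^ 2) * / 6 + r) / L).
    eassert (B3 : Rabs y3 <= _).
    { unfold y3. apply Rabs_div_ge_1_le; [exact HL|]. bound. }
    assert (L3 : y3 * L = A0 * y2 - (y2 * (y + b0) + b1 * y1) * / 2 - A0 * (y1 * (y + b0))
        + 3 * A1 * y1 + y1 * (y ^ 2 + y * b0 + b0 ^ 2) * / 6 + r) by (unfold y3; field; lra).
    clearbody y3.
    assert (E3 : k * y3 = y2 - b2).
    { apply Rmult_eq_reg_r with L; [|lra].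
      replace (k * y3 * L) with (k * (y3 * L)) by ring.
      rewrite Rmult_minus_distr_r, L2, L3.
      replace (b2 * L) with (3 * A1 * b0 - A0 * (b0 ^ 2 - b1) - A2 - b0 * b1 + 1 / 6 * b0 ^ 3)
        by (unfold b2; field; lra).
      replace (k * (A0 * y2 - (y2 * (y + b0) + b1 * y1) * / 2 - A0 * (y1 * (y + b0))
        + 3 * A1 * y1 + y1 * (y ^ 2 + y * b0 + b0 ^ 2) * / 6 + r))
        with (A0 * (k * y2) - (k * y2 * (y + b0) + b1 * (k * y1)) * / 2 - A0 * (k * y1 * (y + b0))
        + 3 * A1 * (k * y1) + k * y1 * (y ^ 2 + y * b0 + b0 ^ 2) * / 6 + k * r) by ring.
      rewrite E1, E2. unfold q. field. }
    exists y1, y2, y3.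
    split; [lra|]. split; [lra|]. split; [lra|].
    split; [exact B1|]. split; [exact B2|exact B3]. }
  destruct H as (Y1 & Y2 & Y3 & H).
  exists (Rabs Y1 + Rabs Y2 + Rabs Y3). intros L y k r HL Hy Hk Hr E b0 b1 b2.
  destruct (H L y k r HL Hy Hk Hr E) as (y1 & y2 & y3 & E1 & E2 & E3 & B1 & B2 & B3).
  fold b0 in E1, E2, E3. fold b1 in E2, E3. fold b2 in E3.
  assert (P : forall a A j, Rabs a <= A -> A <= Rabs Y1 + Rabs Y2 + Rabs Y3 ->
    Rabs (k ^ j * a) <= (Rabs Y1 + Rabs Y2 + Rabs Y3) * k ^ j).
  { intros a A j Ha HA. rewrite Rabs_mult, Rabs_pos_eq by (apply pow_le; lra).
    rewrite Rmult_comm. apply Rmult_le_compat_r; [apply pow_le; lra|lra]. }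
  pose proof (Rabs_pos Y1). pose proof (Rabs_pos Y2). pose proof (Rabs_pos Y3).
  pose proof (Rle_abs Y1). pose proof (Rle_abs Y2). pose proof (Rle_abs Y3).
  split; [|split].
  - replace (y - b0) with (k ^ 1 * y1) by (rewrite E1; ring).
    replace k with (k ^ 1) at 2 by ring. apply (P _ Y1); lra.
  - replace (y - (b0 + k * b1)) with (k ^ 2 * y2) by (rewrite E1, E2; ring). apply (P _ Y2); lra.
  - replace (y - (b0 + k * b1 + k ^ 2 * b2)) with (k ^ 3 * y3) by (rewrite E1, E2, E3; ring).
    apply (P _ Y3); lra.
Qed.

(** The second derivative of the left-hand side is [u^2 / (1 + u)], integrated
    twice. *)
Lemma xlnx_expansion (u : R) : Rabs u <= / 2 ->
  Rabs ((1 + u) * ln (1 + u) - u - u ^ 2 / 2 + u ^ 3 / 6) <= 2 * Rabs u ^ 4.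
Proof.
  intros Hu.
  assert (P : forall t v, Rabs t <= Rabs v -> Rabs v <= Rabs u -> / 2 <= 1 + t).
  { intros t v Ht Hv. assert (H : Rabs t <= / 2) by lra. apply Rabs_le_between in H. lra. }
  assert (D : forall t, Rabs t <= Rabs u -> Rabs (ln (1 + t) - t + t ^ 2 / 2) <= 2 * Rabs t ^ 3).
  { intros t Ht.
    apply (taylor_integrate (fun t => ln (1 + t) - t + t ^ 2 / 2) (fun t => t ^ 2 / (1 + t)));
      [rewrite Rplus_0_r, ln_1; field|lra|].
    intros v Hv. pose proof (P v t Hv Ht). split.
    - auto_derive; [lra|field; lra].
    - unfold Rdiv. rewrite Rabs_mult, RPow_abs, Rmult_comm.
      apply Rmult_le_compat_r; [apply Rabs_pos|].
      rewrite Rabs_pos_eq by (left; apply Rinv_0_lt_compat; lra).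
      replace 2 with (/ / 2) by field. apply Rinv_le_contravar; lra. }
  apply (taylor_integrate (fun u => (1 + u) * ln (1 + u) - u - u ^ 2 / 2 + u ^ 3 / 6)
    (fun t => ln (1 + t) - t + t ^ 2 / 2)); [rewrite Rplus_0_r, ln_1; field|lra|].
  intros t Ht. pose proof (P t u Ht (Rle_refl _)). split; [|now apply D].
  auto_derive; [lra|field; lra].
Qed.

Lemma inv_pow_expansion (a0 a1 a2 Y : R) :
  exists M, forall k y, 0 < k <= 1 -> Rabs y <= Y -> Rabs (k * y) <= / 2 ->
  exists r, Rabs r <= M /\
    a0 / (1 + k * y) + a1 * k / (1 + k * y) ^ 3 + a2 * k ^ 2 / (1 + k * y) ^ 5
    = a0 * (1 - k * y + k ^ 2 * y ^ 2) + a1 * k * (1 - 3 * k * y) + a2 * k ^ 2 + k ^ 3 * r.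
Proof.
  eexists. intros k y Hk Hy Hu. set (u := k * y) in *.
  assert (Hu2 : / 2 <= 1 + u) by (apply Rabs_le_between in Hu; lra).
  set (i := / (1 + u)).
  assert (Hi : Rabs i <= 2).
  { unfold i. rewrite Rabs_pos_eq by (left; apply Rinv_0_lt_compat; lra).
    replace 2 with (/ / 2) by field. apply Rinv_le_contravar; lra. }
  exists (- a0 * y ^ 3 * i + a1 * y ^ 2 * (6 + 8 * u + 3 * u ^ 2) * i ^ 3
    - a2 * y * (5 + 10 * u + 10 * u ^ 2 + 5 * u ^ 3 + u ^ 4) * i ^ 5).
  split; [bound|]. unfold i, u. unfold u in Hu2. field. lra.
Qed.

(** * The zeros in terms of Lambert's function *)

Lemma xexp_lt (a b : R) : 0 <= a -> a < b -> a * exp a < b * exp b.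
Proof.
  intros Ha Hab. apply Rmult_le_0_lt_compat; trivial.
  - left; apply exp_pos.
  - now apply exp_increasing.
Qed.

Lemma LambertW_spec (z : R) : 0 < z -> 0 < LambertW z /\ LambertW z * exp (LambertW z) = z.
Proof.
  intros Hz. unfold LambertW.
  apply (iota_correct (V := R_CompleteNormedModule) (fun w : R => 0 < w /\ w * exp w = z)).
  assert (Ez : z <= z * exp z).
  { pose proof (exp_ineq1_le z). nra. }
  destruct (IVT_gen (fun w => w * exp w) 0 z z) as [w [Hw E]].
  - intros t. apply continuity_pt_filterlim, (ex_derive_continuous (fun w => w * exp w)).
    auto_derive; trivial.
  - rewrite Rmult_0_l. rewrite Rmin_left, Rmax_right; lra.
  - rewrite Rmin_left in Hw by lra.
    assert (Hw0 : 0 < w).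
    { destruct (proj1 Hw) as [H|H]; [exact H|]. rewrite <- H, Rmult_0_l in E. lra. }
    exists w. split; [split; assumption|]. intros v [Hv Ev].
    destruct (Rtotal_order w v) as [H|[H|H]]; [|exact H|]; exfalso.
    + pose proof (xexp_lt w v ltac:(lra) H). lra.
    + pose proof (xexp_lt v w ltac:(lra) H). lra.
Qed.

Lemma lambda_pos (x : R) : 0 < x -> 0 < lambda x.
Proof.
  intros Hx. unfold lambda. apply Rdiv_lt_0_compat; [lra|].
  apply Rmult_lt_0_compat; [apply exp_pos|exact Hx].
Qed.

(** [lambda xi = exp W] with [W = LambertW (lambda m)]. *)
Lemma xi_spec (x m : R) : 0 < x -> 0 < m ->
  0 < xi x m /\ 0 < ln (lambda x * xi x m) /\ xi x m * ln (lambda x * xi x m) = m.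
Proof.
  intros Hx Hm. pose proof (lambda_pos x Hx) as Hl.
  destruct (LambertW_spec (lambda x * m)) as [HW EW]; [now apply Rmult_lt_0_compat|].
  unfold xi. set (W := LambertW (lambda x * m)) in *.
  assert (E : lambda x * (m / W) = exp W).
  { replace (lambda x * (m / W)) with (lambda x * m / W) by (field; lra). rewrite <- EW. field. lra. }
  rewrite E, ln_exp. split; [now apply Rdiv_lt_0_compat|]. split; [exact HW|]. field. lra.
Qed.

(** On a bounded set of [t] the function [t ln (l t)] is bounded above, so that
    arguments tend to infinity when values do. *)
Lemma xlnx_upper (l B t : R) : 0 < l -> 0 < t -> t <= B -> t * ln (l * t) <= B * Rabs (ln (l * B)).
Proof.
  intros Hl Ht HB.
  assert (H1 : ln (l * t) <= ln (l * B)).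
  { apply ln_le; [now apply Rmult_lt_0_compat|]. apply Rmult_le_compat_l; lra. }
  pose proof (Rle_abs (ln (l * B))). pose proof (Rabs_pos (ln (l * B))).
  apply Rle_trans with (t * Rabs (ln (l * B))); [apply Rmult_le_compat_l; lra|].
  apply Rmult_le_compat_r; lra.
Qed.

(** The derivative [1 + ln (l t)] is at least [1] for [t >= 1/l]. *)
Lemma xlnx_expanding (l a b : R) : 0 < l -> / l <= a -> / l <= b ->
  Rabs (a - b) <= Rabs (a * ln (l * a) - b * ln (l * b)).
Proof.
  intros Hl Ha Hb. pose proof (Rinv_0_lt_compat l Hl) as Hil.
  destruct (MVT_gen (fun t => t * ln (l * t)) b a (fun t => 1 + ln (l * t))) as [c [Hc E]].
  - intros t Ht. assert (0 < t) by (revert Ht; unfold Rmin; destruct (Rle_dec b a); lra).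
    auto_derive; [now apply Rmult_lt_0_compat|]. field. split; lra.
  - intros t Ht. assert (0 < t) by (revert Ht; unfold Rmin; destruct (Rle_dec b a); lra).
    apply continuity_pt_filterlim, (ex_derive_continuous (fun t => t * ln (l * t))).
    auto_derive. now apply Rmult_lt_0_compat.
  - rewrite E, Rabs_mult.
    assert (H1 : / l <= c) by (revert Hc; unfold Rmin; destruct (Rle_dec b a); lra).
    assert (H2 : 0 <= ln (l * c)).
    { rewrite <- ln_1. apply ln_le; [lra|].
      replace 1 with (l * / l) by (field; lra). apply Rmult_le_compat_l; lra. }
    rewrite (Rabs_pos_eq (1 + _)) by lra. pose proof (Rabs_pos (a - b)).
    rewrite <- (Rmult_1_l (Rabs (a - b))) at 1. apply Rmult_le_compat_r; lra.
Qed.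

(** The coefficient that continues the sequence [b0], [b1]. *)
Definition b2 (x m : R) : R :=
  (3 * A1 x * b0 x m - A0 x * (b0 x m ^ 2 - b1 x m) - A2 x
   - b0 x m * b1 x m + 1 / 6 * b0 x m ^ 3) / (1 + ln (lambda x * xi x m)).

(** A crude bound comes first: [t ln (lambda t)] expands distances, so [nu - xi] is
    [O (1/xi)].  Then [y = xi (nu - xi)] is bounded and [u = y / xi^2] is small, and
    the expansions in [u] bring the equation into the form treated by
    [implicit_expansion]. *)
Lemma expansion_around_xi (x Mr : R) : 0 < x -> 0 <= Mr ->
  exists M X, 0 < X /\ forall m nu, 0 < m -> X <= xi x m -> X <= nu ->
    Rabs (nu * ln (lambda x * nu) + (A0 x / nu + A1 x / nu ^ 3 + A2 x / nu ^ 5) - m) <= Mr / nu ^ 7 ->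
    let h := / xi x m in
    Rabs (nu - (xi x m + h * b0 x m)) <= M * h ^ 3 /\
    Rabs (nu - (xi x m + (h * b0 x m + h ^ 3 * b1 x m))) <= M * h ^ 5 /\
    Rabs (nu - (xi x m + (h * b0 x m + h ^ 3 * b1 x m + h ^ 5 * b2 x m))) <= M * h ^ 7.
Proof.
  intros Hx HMr. set (l := lambda x). pose proof (lambda_pos x Hx : 0 < l) as Hl.
  pose proof (Rinv_0_lt_compat l Hl) as Hil.
  set (D := Rabs (A0 x) + Rabs (A1 x) + Rabs (A2 x) + Mr).
  pose proof (Rabs_pos (A0 x)) as P0. pose proof (Rabs_pos (A1 x)) as P1.
  pose proof (Rabs_pos (A2 x)) as P2.
  assert (HD : 0 <= D) by (unfold D; lra).
  set (Y := 2 * D).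
  destruct (inv_pow_expansion (A0 x) (A1 x) (A2 x) Y) as [Me He].
  destruct (implicit_expansion (A0 x) (A1 x) (A2 x) Y (128 * Mr + 2 * Y ^ 4 + Me)) as [M HM].
  (* /l makes both arguments of xlnx_expanding admissible; 2 D keeps nu above xi / 2 *)
  exists M, (1 + / l + 2 * D). split; [lra|].
  intros m nu Hm HX Hnu Hr h.
  destruct (xi_spec x m Hx Hm) as (Hxi & HW & EW). unfold b2, b1, b0.
  fold l in HW, EW, Hr |- *.
  set (xi0 := xi x m) in *. set (W := ln (l * xi0)) in *.
  set (a := A0 x / nu + A1 x / nu ^ 3 + A2 x / nu ^ 5) in *.
  set (R7 := nu * ln (l * nu) + a - m) in *.
  assert (Hnu1 : 1 <= nu) by lra.
  assert (Hinv : forall j, / nu ^ S j <= / nu).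
  { intros j. apply Rinv_le_contravar; [lra|]. rewrite <- (pow_1 nu) at 1.
    apply Rle_pow; [lra|lia]. }
  assert (Hpos : forall j, 0 < / nu ^ j).
  { intros j. apply Rinv_0_lt_compat, pow_lt. lra. }
  assert (Hdiff : Rabs (nu - xi0) <= D / nu).
  { eapply Rle_trans; [apply (xlnx_expanding l); lra|]. fold W. rewrite EW.
    replace (nu * ln (l * nu) - m) with (R7 - a) by (unfold R7; ring).
    assert (T : forall c j, Rabs (c / nu ^ S j) <= Rabs c * / nu).
    { intros c j. unfold Rdiv. rewrite Rabs_mult, (Rabs_pos_eq (/ _)) by (left; apply Hpos).
      apply Rmult_le_compat_l; [apply Rabs_pos|apply Hinv]. }
    assert (Ha : Rabs a <= Rabs (A0 x) * / nu + Rabs (A1 x) * / nu + Rabs (A2 x) * / nu).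
    { unfold a. apply Rabs_plus_le; [apply Rabs_plus_le|]; [|apply T|apply T].
      pose proof (T (A0 x) 0%nat) as T0. rewrite pow_1 in T0. exact T0. }
    assert (H7 : Mr / nu ^ 7 <= Mr * / nu) by (apply Rmult_le_compat_l; [exact HMr|apply Hinv]).
    replace (D / nu) with (Mr * / nu + (Rabs (A0 x) * / nu + Rabs (A1 x) * / nu + Rabs (A2 x) * / nu))
      by (unfold D; field; lra).
    apply Rabs_minus_le; lra. }
  assert (HDnu : D / nu <= D).
  { rewrite <- (Rmult_1_r D) at 2. apply Rmult_le_compat_l; [exact HD|].
    rewrite <- Rinv_1. apply Rinv_le_contravar; lra. }
  assert (Hxi1 : 1 <= xi0) by lra.
  assert (Hhalf : xi0 / 2 <= nu).
  { assert (H : Rabs (nu - xi0) <= D) by lra. apply Rabs_le_between in H. lra. }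
  set (y := (nu - xi0) * xi0). set (k := h ^ 2).
  assert (Hh : 0 < h <= 1).
  { unfold h. split; [apply Rinv_0_lt_compat; lra|]. rewrite <- Rinv_1. apply Rinv_le_contravar; lra. }
  assert (Hk : 0 < k <= 1) by (unfold k; split; nra).
  assert (Hy : Rabs y <= Y).
  { unfold y. rewrite Rabs_mult, (Rabs_pos_eq xi0) by lra.
    apply Rle_trans with (D / nu * xi0); [apply Rmult_le_compat_r; lra|].
    replace (D / nu * xi0) with (D * (xi0 / nu)) by (field; lra).
    unfold Y. rewrite (Rmult_comm 2). apply Rmult_le_compat_l; [exact HD|].
    apply Rmult_le_reg_r with nu; [lra|]. unfold Rdiv. rewrite Rmult_assoc, Rinv_l; lra. }
  set (u := k * y). assert (Eu : u = nu / xi0 - 1) by (unfold u, k, y, h; field; lra).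
  assert (Hu : Rabs u <= / 2).
  { replace u with ((nu - xi0) * h) by (rewrite Eu; unfold h; field; lra).
    rewrite Rabs_mult, (Rabs_pos_eq h) by lra.
    apply Rmult_le_reg_r with xi0; [lra|]. rewrite Rmult_assoc. unfold h at 1. rewrite Rinv_l by lra. lra. }
  destruct (He k y Hk Hy Hu) as [re [Hre Ere]]. fold u in Ere.
  pose proof (xlnx_expansion u Hu) as He1.
  set (e1 := (1 + u) * ln (1 + u) - u - u ^ 2 / 2 + u ^ 3 / 6) in *.
  assert (Hu1 : / 2 <= 1 + u) by (apply Rabs_le_between in Hu; lra).
  assert (Enu : nu = xi0 * (1 + u)) by (rewrite Eu; field; lra).
  assert (Hr1 : Rabs (xi0 ^ 8 * e1) <= 2 * Y ^ 4).
  { rewrite Rabs_mult, Rabs_pos_eq by (apply pow_le; lra).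
    apply Rle_trans with (xi0 ^ 8 * (2 * Rabs u ^ 4)); [apply Rmult_le_compat_l; [apply pow_le|]; lra|].
    replace (xi0 ^ 8 * (2 * Rabs u ^ 4)) with (2 * Rabs y ^ 4).
    - apply Rmult_le_compat_l; [lra|]. apply pow_incr. split; [apply Rabs_pos|exact Hy].
    - unfold u. rewrite Rabs_mult, (Rabs_pos_eq k) by lra. unfold k, h. field. lra. }
  assert (Hr2 : Rabs (xi0 ^ 7 * R7) <= 128 * Mr).
  { rewrite Rabs_mult, Rabs_pos_eq by (apply pow_le; lra).
    apply Rle_trans with (xi0 ^ 7 * (Mr / nu ^ 7)); [apply Rmult_le_compat_l; [apply pow_le|]; lra|].
    apply Rmult_le_reg_r with (nu ^ 7); [apply pow_lt; lra|].
    replace (xi0 ^ 7 * (Mr / nu ^ 7) * nu ^ 7) with (Mr * xi0 ^ 7) by (field; lra).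
    replace (128 * Mr * nu ^ 7) with (Mr * (2 * nu) ^ 7) by ring.
    apply Rmult_le_compat_l; [exact HMr|]. apply pow_incr. lra. }
  assert (Hxh : xi0 * h = 1) by (unfold h; field; lra).
  assert (E : y * (1 + W) = - A0 x * (1 - k * y + k ^ 2 * y ^ 2) - A1 x * k * (1 - 3 * k * y)
      - A2 x * k ^ 2 - k * y ^ 2 / 2 + k ^ 2 * y ^ 3 / 6
      + k ^ 3 * (xi0 ^ 7 * R7 - xi0 ^ 8 * e1 - re)).
  { assert (Ea : xi0 * a = A0 x / (1 + u) + A1 x * k / (1 + u) ^ 3 + A2 x * k ^ 2 / (1 + u) ^ 5).
    { unfold a. rewrite Enu. unfold k, h. field. split; lra. }
    rewrite Ere in Ea.
    assert (ER : R7 = xi0 * (u * (1 + W) + u ^ 2 / 2 - u ^ 3 / 6 + e1) + a).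
    { unfold R7. replace (ln (l * nu)) with (W + ln (1 + u)).
      - rewrite <- EW. fold W. rewrite Enu. unfold e1. field.
      - rewrite Enu. unfold W. rewrite <- ln_mult by (try apply Rmult_lt_0_compat; lra).
        f_equal. ring. }
    assert (K1 : k ^ 3 * (xi0 ^ 7 * R7) = xi0 * R7) by (unfold k, h; field; lra).
    assert (K2 : k ^ 3 * (xi0 ^ 8 * e1) = xi0 ^ 2 * e1) by (unfold k, h; field; lra).
    assert (K3 : xi0 ^ 2 * u = y) by (unfold u, k, h; field; lra).
    assert (K4 : xi0 ^ 2 * u ^ 2 = k * y ^ 2) by (unfold u, k, h; field; lra).
    assert (K5 : xi0 ^ 2 * u ^ 3 = k ^ 2 * y ^ 3) by (unfold u, k, h; field; lra).
    rewrite !(Rmult_minus_distr_l (k ^ 3)), K1, K2, ER, (Rmult_plus_distr_l xi0 _ a), Ea.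
    replace (xi0 * (xi0 * (u * (1 + W) + u ^ 2 / 2 - u ^ 3 / 6 + e1)))
      with (xi0 ^ 2 * u * (1 + W) + xi0 ^ 2 * u ^ 2 / 2 - xi0 ^ 2 * u ^ 3 / 6 + xi0 ^ 2 * e1) by field.
    rewrite K3, K4, K5. unfold u. ring. }
  destruct (HM (1 + W) y k (xi0 ^ 7 * R7 - xi0 ^ 8 * e1 - re)) as (G0 & G1 & G2); trivial; [lra| |].
  { apply Rabs_minus_le; [apply Rabs_minus_le|]; assumption. }
  clear HM He.
  set (c0 := - A0 x / (1 + W)) in *.
  set (c1 := (A0 x * c0 - A1 x - 1 / 2 * c0 ^ 2) / (1 + W)) in *.
  set (c2 := (3 * A1 x * c0 - A0 x * (c0 ^ 2 - c1) - A2 x - c0 * c1 + 1 / 6 * c0 ^ 3) / (1 + W)) in *.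
  assert (Ed : nu = xi0 + h * y) by (unfold y, h; field; lra).
  assert (S : forall v j, Rabs (y - v) <= M * k ^ j ->
    Rabs (nu - (xi0 + h * v)) <= M * h ^ (2 * j + 1)).
  { intros v j Hv. rewrite Ed at 1. replace (xi0 + h * y - (xi0 + h * v)) with (h * (y - v)) by ring.
    rewrite Rabs_mult, (Rabs_pos_eq h) by lra.
    replace (M * h ^ (2 * j + 1)) with (h * (M * k ^ j))
      by (unfold k; rewrite <- pow_mult, pow_add; ring).
    apply Rmult_le_compat_l; lra. }
  split; [|split].
  - apply (S c0 1%nat). rewrite pow_1. exact G0.
  - replace (h * c0 + h ^ 3 * c1) with (h * (c0 + k * c1)) by (unfold k; ring).
    apply (S _ 2%nat G1).
  - replace (h * c0 + h ^ 3 * c1 + h ^ 5 * c2) with (h * (c0 + k * c1 + k ^ 2 * c2))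
      by (unfold k; ring).
    apply (S _ 3%nat G2).
Qed.

(** * From the labelling to the expansion *)

Lemma Rabs_le_2_sin (y : R) : Rabs y <= / 2 -> Rabs y <= 2 * Rabs (sin y).
Proof.
  intros Hy. pose proof (Rabs_sub_sin_le y) as H. pose proof (Rabs_pos y) as P.
  assert (Rabs y ^ 3 <= Rabs y / 2).
  { replace (Rabs y ^ 3) with (Rabs y * Rabs y * Rabs y) by ring.
    assert (Rabs y * Rabs y <= / 2) by nra. nra. }
  pose proof (Rabs_triang (y - sin y) (sin y)) as T.
  replace (y - sin y + sin y) with y in T by ring. lra.
Qed.

Lemma Rabs_cos_half_period (y : R) (n : nat) :
  Rabs (cos (y + (INR n + 1 / 2) * PI)) = Rabs (sin y).
Proof.
  induction n as [|n IH].
  - simpl INR. replace (y + (0 + 1 / 2) * PI) with (PI / 2 + y) by field.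
    rewrite cos_plus, cos_PI2, sin_PI2.
    replace (0 * cos y - 1 * sin y) with (- sin y) by ring. apply Rabs_Ropp.
  - rewrite S_INR. replace (y + (INR n + 1 + 1 / 2) * PI) with (y + (INR n + 1 / 2) * PI + PI) by ring.
    rewrite neg_cos, Rabs_Ropp. exact IH.
Qed.

Lemma INR_PI_eventually_ge (B : R) : exists N, forall n, (N <= n)%nat -> B <= INR n * PI.
Proof.
  destruct (INR_unbounded B) as [N HN]. exists N. intros n Hn.
  pose proof (le_INR _ _ Hn). pose proof PI2_3_2. pose proof (pos_INR n). unfold PI2 in *. nra.
Qed.

(** The labelling forces [Phi (nu n)] to infinity, while [Phi] is bounded above on
    bounded sets. *)
Lemma zeros_unbounded (x : R) (nu : nat -> R) : 0 < x -> is_zero_labelling x nu ->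
  forall B, exists N, forall n, (N <= n)%nat -> B <= nu n.
Proof.
  intros Hx [[N0 H0] Hlim] B. set (B' := Rabs B + 1).
  assert (HB' : B < B') by (unfold B'; pose proof (Rle_abs B); lra).
  apply is_lim_seq_spec in Hlim. destruct (Hlim (mkposreal 1 Rlt_0_1)) as [N1 H1].
  destruct (INR_PI_eventually_ge (B' * Rabs (ln (lambda x * B')) + PI + 2)) as [N2 H2].
  exists (N0 + N1 + N2)%nat. intros n Hn.
  destruct (H0 n ltac:(lia)) as [Hpos _]. specialize (H1 n ltac:(lia)). specialize (H2 n ltac:(lia)).
  cbn -[INR Phi] in H1. rewrite Rminus_0_r in H1. apply Rabs_def2 in H1.
  destruct (Rle_dec B (nu n)) as [h|h]; [exact h|exfalso].
  pose proof (xlnx_upper (lambda x) B' (nu n) (lambda_pos x Hx) Hpos ltac:(lra)) as U.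
  unfold Phi in H1. pose proof PI_RGT_0. lra.
Qed.

Lemma m_plus_pos (n : nat) : 0 < m_plus n.
Proof.
  unfold m_plus. pose proof (pos_INR n). pose proof PI_RGT_0. apply Rmult_lt_0_compat; lra.
Qed.

Lemma xi_unbounded (x : R) : 0 < x ->
  forall B, exists N, forall n, (N <= n)%nat -> B <= xi x (m_plus n).
Proof.
  intros Hx B. set (B' := Rabs B + 1).
  assert (HB' : B < B') by (unfold B'; pose proof (Rle_abs B); lra).
  destruct (INR_PI_eventually_ge (B' * Rabs (ln (lambda x * B')))) as [N H].
  exists N. intros n Hn. specialize (H n Hn).
  destruct (xi_spec x (m_plus n) Hx (m_plus_pos n)) as (Hxi & _ & E).
  destruct (Rle_dec B (xi x (m_plus n))) as [h|h]; [exact h|exfalso].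
  pose proof (xlnx_upper (lambda x) B' _ (lambda_pos x Hx) Hxi ltac:(lra)) as U.
  rewrite E in U. unfold m_plus in U. pose proof PI_RGT_0. lra.
Qed.

(** The labelling places the phase of [nu n] within [1/2] of
    [(n + 1/2) PI]; there the cosine controls the distance to that multiple, so the
    smallness of the cosine improves [o (1)] to [O (nu^-7)]. *)
Lemma zero_equation (x : R) (nu : nat -> R) : 0 < x -> is_zero_labelling x nu ->
  exists M N, 0 <= M /\ forall n, (N <= n)%nat ->
    Rabs (nu n * ln (lambda x * nu n) + (A0 x / nu n + A1 x / nu n ^ 3 + A2 x / nu n ^ 5)
      - m_plus n) <= M / nu n ^ 7.
Proof.
  intros Hx Hnu. destruct (zero_condition x Hx) as [M [X [HX [HM HZ]]]].
  set (D := Rabs (A0 x) + Rabs (A1 x) + Rabs (A2 x)).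
  pose proof (Rabs_pos (A0 x)) as P0. pose proof (Rabs_pos (A1 x)) as P1.
  pose proof (Rabs_pos (A2 x)) as P2.
  (* 4 D makes the correction terms of the phase at most 1/4 *)
  destruct (zeros_unbounded x nu Hx Hnu (X + 4 * D)) as [N1 H1].
  destruct Hnu as [[N0 H0] Hlim]. apply is_lim_seq_spec in Hlim.
  assert (e4 : 0 < / 4) by lra. destruct (Hlim (mkposreal _ e4)) as [N2 H2].
  exists (2 * M), (N0 + N1 + N2)%nat. split; [lra|]. intros n Hn.
  destruct (H0 n ltac:(lia)) as [_ HL]. specialize (H1 n ltac:(lia)). specialize (H2 n ltac:(lia)).
  cbn -[INR Phi] in H2. rewrite Rminus_0_r in H2. set (v := nu n) in *.
  assert (HD : 0 <= D) by (unfold D; lra).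
  specialize (HZ v ltac:(lra) HL).
  set (a := A0 x / v + A1 x / v ^ 3 + A2 x / v ^ 5) in *.
  set (y := v * ln (lambda x * v) + a - m_plus n).
  assert (Hv : 0 < / v) by (apply Rinv_0_lt_compat; lra).
  assert (Ha : Rabs a <= / 4).
  { assert (T : forall c j, Rabs (c / v ^ S j) <= Rabs c * / v).
    { intros c j. unfold Rdiv. rewrite Rabs_mult.
      assert (P : 0 < v ^ S j) by (apply pow_lt; lra).
      rewrite (Rabs_pos_eq (/ _)) by (left; now apply Rinv_0_lt_compat).
      apply Rmult_le_compat_l; [apply Rabs_pos|].
      apply Rinv_le_contravar; [lra|]. rewrite <- (pow_1 v) at 1. apply Rle_pow; [lra|lia]. }
    pose proof (T (A0 x) 0%nat) as T0. rewrite pow_1 in T0.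
    assert (Rabs a <= Rabs (A0 x) * / v + Rabs (A1 x) * / v + Rabs (A2 x) * / v).
    { unfold a. apply Rabs_plus_le; [apply Rabs_plus_le|]; [exact T0|apply T|apply T]. }
    apply Rle_trans with (D * / v); [unfold D; lra|].
    apply Rmult_le_reg_r with v; [lra|]. rewrite Rmult_assoc, Rinv_l by lra. lra. }
  assert (Ey : phase x v = y + (INR n + 1 / 2) * PI).
  { unfold phase. fold a. unfold y, Phi, m_plus. field. }
  rewrite Ey, Rabs_cos_half_period in HZ.
  assert (Hy : Rabs y <= / 2).
  { replace y with (a - ((INR n + 1 / 2) * PI - Phi x v)).
    - replace (/ 2) with (/ 4 + / 4) by field. apply Rabs_minus_le; [exact Ha|lra].
    - unfold y, Phi, m_plus. field. }
  pose proof (Rabs_le_2_sin y Hy). unfold Rdiv in *. lra.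
Qed.

Lemma Bcoef_sum (x m : R) : 0 < x -> 0 < m ->
  let h := / xi x m in
  B0 x m / m = h * b0 x m /\ B1 x m / m ^ 3 = h ^ 3 * b1 x m /\ B2 x m / m ^ 5 = h ^ 5 * b2 x m.
Proof.
  intros Hx Hm h. destruct (xi_spec x m Hx Hm) as (Hxi & HW & E).
  unfold B0, B1, B2, rho. unfold b2. unfold b1 at 1. unfold b0 at 1.
  generalize dependent (ln (lambda x * xi x m)). intros W HW E. unfold h.
  generalize (b1 x m), (b0 x m). generalize dependent (xi x m). intros z Hxi E c1 c0. subst m.
  repeat split; field; repeat split; lra.
Qed.

Theorem theorem1 (x : R) (hx : 0 < x) (nu : nat -> R)
    (hnu : is_zero_labelling x nu) (K : nat) (hK : (K <= 2)%nat) :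
  exists (M : R) (N : nat), forall n : nat, (N <= n)%nat ->
    Rabs (nu n - (xi x (m_plus n)
                  + sum_n (fun k => Bcoef x (m_plus n) k
                                    / m_plus n ^ (2 * k + 1)) K))
    <= M * / xi x (m_plus n) ^ (2 * K + 3).
Proof.
  destruct (zero_equation x nu hx hnu) as [Mr [N1 [HMr H1]]].
  destruct (expansion_around_xi x Mr hx HMr) as [M [X [HX H]]].
  destruct (zeros_unbounded x nu hx hnu X) as [N2 H2].
  destruct (xi_unbounded x hx X) as [N3 H3].
  exists M, (N1 + N2 + N3)%nat. intros n Hn.
  specialize (H1 n ltac:(lia)). specialize (H2 n ltac:(lia)). specialize (H3 n ltac:(lia)).
  pose proof (m_plus_pos n) as Hm. set (m := m_plus n) in *.
  destruct (H m (nu n) Hm H3 H2 H1) as (G0 & G1 & G2).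
  destruct (Bcoef_sum x m hx Hm) as (E0 & E1 & E2).
  rewrite <- E0 in G0, G1, G2. rewrite <- E1 in G1, G2. rewrite <- E2 in G2.
  rewrite pow_inv in G0, G1, G2.
  destruct K as [|[|[|K]]]; [| | |lia].
  - rewrite sum_O. cbn [Bcoef]. change (2 * 0 + 1)%nat with 1%nat. rewrite pow_1. exact G0.
  - rewrite sum_Sn, sum_O. change plus with Rplus. cbn [Bcoef].
    change (2 * 0 + 1)%nat with 1%nat. rewrite pow_1. exact G1.
  - rewrite !sum_Sn, sum_O. change plus with Rplus. cbn [Bcoef].
    change (2 * 0 + 1)%nat with 1%nat. rewrite pow_1. exact G2.
Qed.
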